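(* Let $a$ be a weak composition of length $n$. Then $$\hat\kappa_a = \sum_{f(c) \sim \mathrm{col}(\mathrm{key}(a)), \, w \textrm{ is $c$-compatible}} x^{\mathrm{comp}(f(w))}.$$
   Context: The Young key polynomial is $\hat\kappa_a(x_1,\ldots,x_n)=\kappa_{\mathrm{rev}(a)}(x_n,\ldots,x_1)$, where $\kappa_b=\pi_{w_b}x^{\mathrm{sort}(b)}$ is the key polynomial (Demazure character), with $\pi_i f=\partial_i(x_if)$, $\partial_i f=(f-s_if)/(x_i-x_{i+1})$, $w_b$ the minimal length permutation sending $b$ to its decreasing rearrangement $\mathrm{sort}(b)$, and $\mathrm{rev}(a)$ the reversal of $a$. $\mathrm{key}(a)$ is the unique key (a semistandard Young tableau in which each column's entry set contains the next column's entry set) of weight $a$, and $\mathrm{col}(T)$ is the column reading word of $T$ (reading entries down each column, columns from left to right). $\sim$ denotes Knuth equivalence of words. For a word $w$ in $\{1,\ldots,n\}$, the flip $f(w)$ replaces each letter $w_i$ by $n+1-w_i$. Given a word $c=c_1\cdots c_p$, a word $w=w_1\cdots w_p$ is $c$-compatible if $1\le w_1\le\cdots\le w_p\le n$, $w_k<w_{k+1}$ whenever $c_k<c_{k+1}$, and $w_k\le c_k$ for all $k$. $\mathrm{comp}(w)$ is the weak composition whose $i$th entry counts occurrences of $i$ in $w$. *)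

(* Defs.v *)
From mathcomp Require Import all_boot all_order all_fingroup all_algebra.
From mathcomp.multinomials Require Import mpoly.

Set Implicit Arguments.
Unset Strict Implicit.
Unset Printing Implicit Defensive.

Import GRing.Theory.

(* Conventions.  The set {1, ..., n} is represented by 'I_n, the ordinal i
   standing for i + 1; n + 1 - x is then rev_ord.  Weak compositions of length n
   are monomial exponents a : 'X_{1..n}, so that x^a is 'X_[a].
   Tableaux are drawn in French notation (rows weakly increasing from left to
   right, columns strictly increasing from bottom to top). *)

(** * Simple transpositions, length, reduced words *)

Section Coxeter.
Variable n : nat.
Implicit Types (i : 'I_n.-1) (w : 'S_n) (s : seq 'I_n.-1).

Definition pos0 i : 'I_n := widen_ord (leq_pred n) i.

Lemma pos1_subproof i : (i.+1 < n)%N.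
Proof. by rewrite -ltn_predRL. Qed.

Definition pos1 i : 'I_n := Ordinal (pos1_subproof i).

Definition simple_tperm i : 'S_n := tperm (pos0 i) (pos1 i).

(* Products in 'S_n are read from left to right: (u * v) x = v (u x). *)
Definition word_perm s : 'S_n := (\prod_(i <- s) simple_tperm i)%g.

Definition has_word w (k : nat) : bool :=
  [exists s : k.-tuple 'I_n.-1, word_perm s == w].

Lemma word_perm_cat s t : word_perm (s ++ t) = (word_perm s * word_perm t)%g.
Proof. exact: big_cat. Qed.

Lemma tperm_word (x y : 'I_n) : exists s, word_perm s = tperm x y.
Proof.
wlog xy : x y / (x <= y)%N.
  move=> H; case/orP: (leq_total x y) => [/H //|/H[s Hs]].
  by exists s; rewrite tpermC.
have [d] := ubnP (y - x)%N; elim: d x xy => // d IHd x xy dxy.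
have [<-|neq_xy] := eqVneq x y; first by exists [::]; rewrite tperm1 /word_perm big_nil.
have ltxy : (x < y)%N by rewrite ltn_neqAle neq_xy.
have ltx : (x < n.-1)%N by rewrite ltn_predRL (leq_ltn_trans ltxy).
pose i := Ordinal ltx.
have p0 : pos0 i = x by apply: val_inj.
have [||s Hs] := IHd (pos1 i); first by [].
  by rewrite /= subnS -ltnS (leq_trans _ dxy) // ltnS prednK // subn_gt0.
have [e1|ne1] := eqVneq (pos1 i) y.
  by exists [:: i]; rewrite /word_perm big_seq1 /simple_tperm p0 e1.
exists ([:: i] ++ s ++ [:: i]).
rewrite !word_perm_cat Hs /word_perm big_seq1 /simple_tperm p0.
have nex : x != pos1 i by rewrite -val_eqE /= neq_ltn ltnSn.
rewrite -{1}[tperm x _]tpermV mulgA -/(conjg _ _) -mulgA.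
by rewrite -/(conjg (tperm (pos1 i) y) (tperm x (pos1 i))) tpermJ tpermR tpermD // eq_sym.
Qed.

Lemma has_word_ex w : exists k, has_word w k.
Proof.
suff [s Hs] : exists s, word_perm s = w.
  by exists (size s); apply/existsP; exists (in_tuple s); apply/eqP.
have [ts -> _] := prod_tpermP w; elim: ts => [|[x y] ts [s Hs]].
  by exists [::]; rewrite /word_perm !big_nil.
have [t Ht] := tperm_word x y.
by exists (t ++ s); rewrite word_perm_cat Ht Hs big_cons.
Qed.

Definition perm_length w : nat := ex_minn (has_word_ex w).

Lemma reduced_word_ex w :
  exists s : (perm_length w).-tuple 'I_n.-1, word_perm s == w.
Proof. by rewrite /perm_length; case: ex_minnP => k /existsP. Qed.

Definition reduced_word w : seq 'I_n.-1 := xchoose (reduced_word_ex w).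

End Coxeter.

(** * Divided differences and Demazure operators *)

Section Demazure.
Variable n : nat.
Implicit Types (i : 'I_n.-1) (f g : {mpoly int[n]}).
Local Open Scope ring_scope.

Definition divdiff_spec i f g : bool :=
  g * ('X_(pos0 i) - 'X_(pos1 i)) == f - msym (simple_tperm i) f.

Lemma divdiff_ex i f : exists g, divdiff_spec i f g.
Proof.
have HD (x y : {mpoly int[n]}) : (exists g, divdiff_spec i x g) ->
    (exists g, divdiff_spec i y g) -> exists g, divdiff_spec i (x + y) g.
  move=> [g /eqP Hg] [h /eqP Hh]; exists (g + h); apply/eqP.
  by rewrite mulrDl Hg Hh msymD opprD addrACA.
have HM (x y : {mpoly int[n]}) : (exists g, divdiff_spec i x g) ->
    (exists g, divdiff_spec i y g) -> exists g, divdiff_spec i (x * y) g.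
  move=> [g /eqP Hg] [h /eqP Hh].
  exists (g * y + msym (simple_tperm i) x * h); apply/eqP.
  rewrite mulrDl mulrAC Hg -mulrA Hh msymM mulrBl mulrBr addrA.
  by rewrite subrK.
have HC (c : int) : exists g, divdiff_spec i c%:MP g.
  exists 0; have -> : c%:MP = c *: 1 :> {mpoly int[n]}.
    by rewrite -mul_mpolyC mulr1.
  by apply/eqP; rewrite mul0r msymZ msym1 subrr.
have HX (k : 'I_n) : exists g, divdiff_spec i 'X_k g.
  have sX : msym (simple_tperm i) ('X_k : {mpoly int[n]})
      = 'X_(simple_tperm i k).
    rewrite msymX; congr 'X_[_]; apply/mnmP=> j; rewrite !mnmE.
    rewrite tpermV; congr (nat_of_bool _).
    by apply/eqP/eqP=> [->|<-]; rewrite tpermK.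
  rewrite /divdiff_spec sX /simple_tperm.
  case: tpermP => [->|->|_ _].
  - by exists 1; rewrite mul1r.
  - by exists (-1); rewrite mulN1r opprB.
  - by exists 0; rewrite mul0r subrr.
elim/mpolyind: f => [|c m p _ _ Hp]; first by exact: (HC 0).
apply: HD Hp; rewrite -mul_mpolyC; apply: (HM) => //; rewrite mpolyXE_id.
apply: (big_ind (fun p => exists g, divdiff_spec i p g)) => [|p1 p2|k _].
- exact: (HC 1).
- exact: HM.
elim: (m k) => [|e IHe]; first exact: (HC 1).
by rewrite exprS; exact: HM.
Qed.

(* The quotient is unique since {mpoly int[n]} is an integral domain. *)
Definition divdiff i f : {mpoly int[n]} := xchoose (divdiff_ex i f).

Definition demazure i f : {mpoly int[n]} := divdiff i ('X_(pos0 i) * f).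

Definition demazure_perm (w : 'S_n) f : {mpoly int[n]} :=
  foldr demazure f (reduced_word w).

End Demazure.

(** * Key polynomials and Young key polynomials *)

Section KeyPolynomials.
Variable n : nat.
Implicit Types a b : 'X_{1..n}.

Definition sort_comp b : 'X_{1..n} := [multinom of sort_tuple geq b].

(* w moves the entry in position i to position w i.  As products are read from
   left to right, a reduced word s_1 ... s_k of the minimal such w rearranges b
   into sort(b) by swapping at s_1 first, and pi_(s_1) is the outermost operator
   of kappa_b, so that kappa_b = pi_i kappa_(s_i b) whenever b_i < b_(i+1). *)
Definition sends_to_sort b (w : 'S_n) : bool :=
  [forall i, sort_comp b (w i) == b i].

Lemma sends_to_sort_ex b : exists w, sends_to_sort b w.
Proof.
have /tuple_permP[p Hp] : perm_eq b (sort_tuple geq b).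
  by rewrite perm_sym perm_sort.
exists p; apply/forallP => i; apply/eqP.
have /val_inj/(congr1 (fun t => tnth t i)) := Hp.
by rewrite tnth_mktuple => Hi; rewrite /fun_of_multinom Hi.
Qed.

Definition sorting_perm b : 'S_n :=
  [arg min_(w < xchoose (sends_to_sort_ex b) | sends_to_sort b w)
     perm_length w].

Definition key_poly b : {mpoly int[n]} :=
  demazure_perm (sorting_perm b) 'X_[sort_comp b].

Definition rev_comp a : 'X_{1..n} := [multinom a (rev_ord i) | i < n].

Definition young_key_poly a : {mpoly int[n]} :=
  key_poly (rev_comp a) \mPo [tuple 'X_(rev_ord i) | i < n].

End KeyPolynomials.

(** * Words, tableaux and keys *)

Section Words.
Variable n : nat.
Local Notation word := (seq 'I_n).
Implicit Types (u v : word).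

Definition word_comp u : 'X_{1..n} := [multinom count_mem i u | i < n].

Definition flip p (c : p.-tuple 'I_n) : p.-tuple 'I_n :=
  map_tuple (@rev_ord n) c.

(* The elementary relations yxz ~ yzx (x < y <= z) and xzy ~ zxy (x <= y < z) *)
Definition knuth_triple u v : bool :=
  [exists x : 'I_n, exists y : 'I_n, exists z : 'I_n,
    [&& (x < y <= z)%N, u == [:: y; x; z] & v == [:: y; z; x]]
    || [&& (x <= y < z)%N, u == [:: x; z; y] & v == [:: z; x; y]]].

Definition knuth_step u v : bool :=
  has (fun k =>
    [&& take k u == take k v,
        knuth_triple (take 3 (drop k u)) (take 3 (drop k v))
      & drop (k + 3) u == drop (k + 3) v])
    (iota 0 (size u)).

(* The equivalence relation generated by knuth_step; it preserves length, so
   nothing is lost by restricting to words of a fixed length. *)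
Definition knuth_equiv p (c d : p.-tuple 'I_n) : bool :=
  connect (fun c d : p.-tuple 'I_n => knuth_step c d || knuth_step d c) c d.

Definition compatible p (c w : p.-tuple 'I_n) : bool :=
  [&& sorted (fun x y : 'I_n => x <= y)%N w,
      [forall k : 'I_p, forall l : 'I_p,
        (l == k.+1 :> nat) && (tnth c k < tnth c l)%N
          ==> (tnth w k < tnth w l)%N]
    & [forall k : 'I_p, (tnth w k <= tnth c k)%N]].

(* A tableau is the list of its columns, from left to right, each column being
   listed from bottom to top. *)
Definition ssyt (T : seq word) : bool :=
  [&& all (fun C => C != [::]) T,
      all (sorted (fun x y : 'I_n => x < y)%N) T
    & sorted (fun C D : word =>
        (size D <= size C)%N
        && all (fun xy : 'I_n * 'I_n => xy.1 <= xy.2)%N (zip C D)) T].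

Definition is_key (T : seq word) : bool :=
  ssyt T && sorted (fun C D : word => all (fun x => x \in C) D) T.

Definition weight (T : seq word) : 'X_{1..n} := word_comp (flatten T).

Definition column_word (T : seq word) : word := flatten (map rev T).

Lemma zip_subseq_le u v :
  sorted (fun x y : 'I_n => x < y)%N u -> subseq v u ->
  all (fun xy : 'I_n * 'I_n => xy.1 <= xy.2)%N (zip u v).
Proof.
have tr : transitive (fun x y : 'I_n => x < y)%N by move=> y x z; apply: ltn_trans.
elim: u v => [|x u IHu] [|y v] //= pu; have su := path_sorted pu.
case: eqP => [<- sv|_ sv]; first by rewrite leqnn IHu.
apply/andP; split; last by apply: IHu => //; apply: subseq_trans sv; apply: subseq_cons.
apply: ltnW; have /allP := order_path_min tr pu; apply.
by apply: (mem_subseq sv); apply: mem_head.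
Qed.

Lemma key_ex (a : 'X_{1..n}) : exists T, is_key T && (weight T == a).
Proof.
pose col j := [seq i <- enum 'I_n | (j < a i)%N].
pose h := \max_(i < n) a i.
have tr : transitive (fun x y : 'I_n => x < y)%N by move=> y x z; apply: ltn_trans.
have srt j : sorted (fun x y : 'I_n => x < y)%N (col j).
  apply: sorted_filter => //.
  by have := iota_ltn_sorted 0 n; rewrite -val_enum_ord sorted_map.
have sub j : subseq (col j.+1) (col j).
  have -> : col j.+1 = [seq i <- col j | (j.+1 < a i)%N].
    rewrite -filter_predI; apply: eq_filter => i /=.
    by case: ltnP => //= /ltnW ->.
  exact: filter_subseq.
have step (P : rel word) : (forall j, P (col j) (col j.+1)) ->
    sorted P [seq col j | j <- iota 0 h].
  move=> HP; rewrite sorted_map; case: h => //= k.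
  by elim: k 0%N => //= k IHk m; rewrite HP IHk.
exists [seq col j | j <- iota 0 h]; apply/andP; split; last first.
  apply/eqP/mnmP => i; rewrite mnmE count_flatten -map_comp sumnE big_map.
  rewrite (eq_bigr (fun j => nat_of_bool (j < a i)%N)); last first.
    move=> j _ /=; rewrite count_uniq_mem; last exact/filter_uniq/enum_uniq.
    by rewrite mem_filter mem_enum andbT.
  have le_h : (a i <= h)%N by apply: leq_bigmax.
  rewrite -big_mkcond sum1_count -{1}(subnKC le_h) iotaD count_cat.
  rewrite (eq_in_count (a2 := predT)); last by move=> j; rewrite mem_iota => /andP[].
  rewrite count_predT size_iota (eq_in_count (a2 := pred0)) ?count_pred0 ?addn0 //.
  by move=> j; rewrite mem_iota add0n => /andP[aj _]; rewrite ltnNge aj.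
rewrite /is_key /ssyt -!andbA; apply/and4P; split.
- apply/allP => _ /mapP[j jh ->]; apply/negP => /eqP E.
  move: jh; rewrite mem_iota add0n ltnNge => /negP; apply.
  apply/bigmax_leqP => i _; rewrite leqNgt; apply/negP => ji.
  have : i \in col j by rewrite mem_filter ji mem_enum.
  by rewrite E.
- by apply/allP => _ /mapP[j _ ->].
- by apply: step => j; rewrite size_subseq // zip_subseq_le.
- by apply: step => j; apply/allP; apply: mem_subseq.
Qed.

(* Uniqueness: the j-th column of such a T has to be {i | j <= a_i}. *)
Definition key (a : 'X_{1..n}) : seq word := xchoose (key_ex a).

End Words.

(* Main.v *)
Require Import Defs.
From mathcomp Require Import all_boot all_order all_fingroup all_algebra.
From mathcomp.multinomials Require Import mpoly.
From mathcomp Require Import zify ring.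

(* Read f(c) together with w as a word of pairs (w_k, f(c)_k).  The pair (c, w) is
   compatible exactly when these pairs are lexicographically sorted and satisfy
   the flag condition w_k + f(c)_k <= n + 1, so that f(c) is cut by w into weakly
   increasing rows, and the claim becomes a formula for kappa_b, b = rev(a), as a
   sum H(a) over such biwords.

   If a is weakly increasing, every prefix of a word in the Knuth class of key(a)
   has weakly increasing content, and the flags leave a single biword.  Otherwise
   let b_i > b_(i+1), let j and j + 1 be the letters n - i and n + 1 - i, and
   compare a with s_j a.  Turning the unmatched letters j + 1 into j (parenthesis
   matching) is a bijection from the class of key(a) onto the class of
   key(s_j a); it keeps the rows, and it carries the biwords of the first class in
   which row i + 1 may also contain j + 1 onto the flagged biwords of the second.
   Hence H(s_j a) = H(a) + h, where h collects the biwords whose row i + 1 ends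
   with j + 1.  Exchanging the lengths of two consecutive rows inside a Knuth class
   (row insertion, a new cut of the bottom row, reverse insertion) shows that
   H(s_j a) is symmetric in x_i and x_(i+1); applied to row i and to row i + 1
   without its last letter, it shows that x_i h is symmetric as well.  Therefore
   H(s_j a) = pi_i H(a), which is the recursion of the key polynomials along a
   reduced word. *)

Set Implicit Arguments.
Unset Strict Implicit.
Unset Printing Implicit Defensive.

Import GRing.Theory.

(** * Knuth equivalence *)

Section Plactic.
Variable n : nat.
Local Notation word := (seq 'I_n).
Implicit Types (x y z : 'I_n) (u v w l r : word).

(** Knuth equivalence for words of all lengths, closed under contexts, so that proofs can go by
    induction on a derivation. *)
Inductive plactic : word -> word -> Prop :=
| plactic_refl u : plactic u u
| plactic_sym u v : plactic u v -> plactic v u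
| plactic_trans v u w : plactic u v -> plactic v w -> plactic u w
| plactic_ctx l r u v : plactic u v -> plactic (l ++ u ++ r) (l ++ v ++ r)
| plactic_yxz x y z : x < y <= z -> plactic [:: y; x; z] [:: y; z; x]
| plactic_xzy x y z : x <= y < z -> plactic [:: x; z; y] [:: z; x; y].

Lemma plactic_catl l u v : plactic u v -> plactic (l ++ u) (l ++ v).
Proof. by move/(plactic_ctx l [::]); rewrite !cats0. Qed.

Lemma plactic_catr r u v : plactic u v -> plactic (u ++ r) (v ++ r).
Proof. exact: (@plactic_ctx [::]). Qed.

Lemma plactic_cons x u v : plactic u v -> plactic (x :: u) (x :: v).
Proof. exact: (@plactic_catl [:: x]). Qed.

Lemma plactic_perm u v : plactic u v -> perm_eq u v.
Proof.
elim=> {u v} [u|u v _|v u w _ + _|l r u v _|x y z _|x y z _].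
- exact: perm_refl.
- by rewrite perm_sym.
- exact: perm_trans.
- by move=> H; rewrite perm_cat2l perm_cat2r.
- by rewrite perm_cons -(cat1s x) perm_catC.
- by rewrite -!(cat1s _ (_ :: _)) !catA perm_cat2r perm_catC.
Qed.

Lemma knuth_triple_plactic u v : knuth_triple u v -> plactic u v.
Proof.
case/existsP=> x /existsP[y /existsP[z /orP[]/and3P[H /eqP-> /eqP->]]].
  exact: plactic_yxz.
exact: plactic_xzy.
Qed.

Lemma knuth_step_plactic u v : knuth_step u v -> plactic u v.
Proof.
case/hasP=> k _ /and3P[/eqP e1 /knuth_triple_plactic H /eqP e3].
rewrite -(cat_take_drop k u) -(cat_take_drop k v) e1; apply: plactic_catl.
rewrite -(cat_take_drop 3 (drop k u)) -(cat_take_drop 3 (drop k v)).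
by rewrite !drop_drop [(3 + k)%N]addnC e3; apply: plactic_catr.
Qed.

Lemma knuth_step_ctx l r u v : knuth_triple u v ->
  knuth_step (l ++ u ++ r) (l ++ v ++ r).
Proof.
move=> H; have [su sv] : size u = 3 /\ size v = 3.
  by case/existsP: H => x /existsP[y /existsP[z /orP[]/and3P[_ /eqP-> /eqP->]]].
apply/hasP; exists (size l); first by rewrite mem_iota !size_cat su; lia.
have [t3 d3] : (forall w, size w = 3 -> take 3 (w ++ r) = w)
    /\ (forall w, size w = 3 -> drop 3 (w ++ r) = r).
  by split=> w sw; rewrite ?take_size_cat ?drop_size_cat.
by rewrite addnC -!drop_drop !take_size_cat // !drop_size_cat // ?t3 // ?d3 // !eqxx ?H.
Qed.

Lemma knuth_equivP p (c d : p.-tuple 'I_n) :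
  reflect (plactic c d) (knuth_equiv c d).
Proof.
apply: (iffP idP) => [/connectP[s]|].
  elim: s c => [|e s IHs] c /=; first by move=> _ ->; apply: plactic_refl.
  case/andP=> ce pe dE.
  apply: plactic_trans (IHs _ pe dE).
  by case/orP: ce => /knuth_step_plactic // H; apply: plactic_sym.
set e := fun c d : p.-tuple 'I_n => knuth_step c d || knuth_step d c.
have sym_e : connect_sym e by apply: sym_connect_sym => c1 d1; rewrite /e orbC.
(* The context rule only enlarges the general [l] and [r]. The middle word of a transitive step has
   length [p] because equivalent words are permutations of each other. *)
suff H u v : plactic u v -> forall l r (c1 d1 : p.-tuple 'I_n),
    val c1 = l ++ u ++ r -> val d1 = l ++ v ++ r -> connect e c1 d1.
  by move=> cd; apply: (H _ _ cd [::] [::]); rewrite cats0.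
elim=> {u v} [u|u v _ IH|v u w uv IH1 _ IH2|l' r' u v _ IH|x y z H|x y z H] l r c1 d1 E1 E2.
- by rewrite (_ : d1 = c1) //; apply: val_inj; rewrite E1 E2.
- by rewrite sym_e; apply: IH E2 E1.
- have sz : size (l ++ v ++ r) == p.
    by rewrite -(size_tuple c1) E1 !size_cat (perm_size (plactic_perm uv)).
  by apply: (@connect_trans _ e (Tuple sz)); [apply: (IH1 l r)|apply: (IH2 l r)].
- by apply: (IH (l ++ l') (r' ++ r)); rewrite ?E1 ?E2 -!catA.
- apply: connect1; apply/orP; left; rewrite E1 E2; apply: knuth_step_ctx.
  apply/existsP; exists x; apply/existsP; exists y; apply/existsP; exists z.
  by rewrite H !eqxx.
- apply: connect1; apply/orP; left; rewrite E1 E2; apply: knuth_step_ctx.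
  apply/existsP; exists x; apply/existsP; exists y; apply/existsP; exists z.
  by rewrite H !eqxx orbT.
Qed.

(** First [x] moves left past [v], whose letters are at least [y > x]; then [y] moves left past [u],
    whose letters are at most [x]. *)
Lemma plactic_row_insert x y u v :
    sorted (fun a b : 'I_n => a <= b) u -> sorted (fun a b : 'I_n => a <= b) v ->
    all (fun z => z <= x) u -> x < y -> all (fun z => y <= z) v ->
  plactic (u ++ y :: v ++ [:: x]) (y :: u ++ x :: v).
Proof.
move=> su sv ux xy yv.
apply: (@plactic_trans (u ++ y :: x :: v)).
  apply: plactic_catl.
  elim/last_ind: v sv yv => [|v z IHv] sv; first by move=> _; apply: plactic_refl.
  rewrite all_rcons => /andP[yz yv].
  have sv' : sorted (fun a b : 'I_n => a <= b) v.
    by move: sv; rewrite -cats1 => /cat_sorted2[].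
  have -> : y :: x :: rcons v z = (y :: x :: v) ++ [:: z] by rewrite -cats1.
  apply: plactic_trans (plactic_catr [:: z] (IHv sv' yv)).
  rewrite cat_cons -!catA cats1 /=.
  case: (lastP v) sv yv => [|v' a] sv yv.
    by apply/plactic_sym/plactic_yxz; rewrite xy.
  rewrite cat_rcons -!cats1 -!catA /=.
  apply: (@plactic_catl (y :: v')); apply/plactic_sym/plactic_yxz.
  move: yv; rewrite all_rcons => /andP[ya _]; rewrite (leq_trans xy ya) /=.
  move: sv; rewrite -!cats1 -catA => /cat_sorted2[_] /=.
  by rewrite andbT.
rewrite -[x :: v]/([:: x] ++ v) -!cat_cons !catA; apply: plactic_catr.
elim: u su ux => [|a u IHu] /= su; first by move=> _; apply: plactic_refl.
case/andP=> ax ux.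
apply: plactic_trans (plactic_cons a (IHu (path_sorted su) ux)) _.
case: u su ux {IHu} => [|b u] /= su ux.
  by apply: plactic_xzy; rewrite ax.
apply: (@plactic_catr (u ++ [:: x]) [:: a; y; b] [:: y; a; b]).
apply: plactic_xzy; case/andP: su => -> _ /=.
by case/andP: ux => bx _; apply: leq_ltn_trans bx xy.
Qed.

End Plactic.

(** * Exchanging the lengths of two rows *)

Section RowSwap.
Variable n : nat.
Local Notation word := (seq 'I_n).
Implicit Types (x y z : 'I_n) (u v w r t s : word).

Local Notation row := (sorted (fun x y : 'I_n => x <= y)).

Lemma row_leq_trans : transitive (fun x y : 'I_n => x <= y).
Proof. by move=> y x z; apply: leq_trans. Qed.
Local Notation tr := row_leq_trans.

Lemma row_cat u v : row (u ++ v) =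
  [&& row u, row v & all (fun x => all (fun y => x <= y) v) u].
Proof. by rewrite !(sorted_pairwise tr) pairwise_cat andbC andbA. Qed.

Lemma row_cons x v : row (x :: v) = all (fun y => x <= y) v && row v.
Proof. by rewrite -cat1s row_cat /= andbT andbC. Qed.

(* A state (r, t, v) stands for the word rev r ++ t ++ v: the letters of v are
   row-inserted one by one into t, and r stacks the letters bumped so far. *)
Definition state := (word * word * word)%type.

Definition state_word (st : state) : word := rev st.1.1 ++ st.1.2 ++ st.2.

Variant bump : state -> state -> Prop :=
  Bump r t1 y t2 x v of all (fun z => z <= x) t1 & x < y & all (fun z => y <= z) t2 :
    bump (r, t1 ++ y :: t2, x :: v) (y :: r, t1 ++ x :: t2, v).

Definition count_le (c : nat) (s : word) := count (fun z => z <= c) s.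
Definition count_lt (c : nat) (s : word) := count (fun z => z < c) s.

(** The counting clause says that the row [rev r] sits on [t] as in a tableau: its k-th letter
    exceeds the k-th letter of [t]. By the last clause, letters of [t] below an already bumped
    letter are too small to be bumped, so bumps move to the right. *)
Definition bump_inv (st : state) : Prop :=
  let: (r, t, v) := st in
  [/\ row (rev r), row t, row v,
      forall c, count_le c r <= count_lt c t
    & forall y z x, y \in r -> z \in t -> x \in v -> z < y -> z <= x].

Inductive bumps : state -> state -> Prop :=
| bumps_refl st : bumps st st
| bumps_step st1 st2 st3 : bumps st1 st2 -> bump st2 st3 -> bumps st1 st3.

Definition settled (st : state) := row (st.1.2 ++ st.2).

Lemma bump_invP st1 st2 : bump_inv st1 -> bump st1 st2 -> bump_inv st2.
Proof.
move=> I1 B; case: B I1 => r t1 y t2 x v t1x xy yt2 [Sr St Sv K J].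
have /= := Sv; rewrite -/(row (x :: v)) row_cons => /andP[xv Sv'].
move: St; rewrite row_cat row_cons => /and3P[S1 /andP[_ S2] S12].
(* An earlier bumped letter above [y] would force [y <= x] by the last clause of the invariant. *)
have ry z : z \in r -> z <= y.
  move=> zr; rewrite leqNgt; apply/negP => yz.
  have := J z y x zr; rewrite mem_cat !inE !eqxx orbT /= => /(_ isT isT yz).
  by rewrite leqNgt xy.
split=> //.
- rewrite rev_cons -cats1 row_cat Sr /=; apply/allP => z; rewrite mem_rev => zr.
  by rewrite /= ry.
- rewrite row_cat row_cons S1 S2 /= andbT; apply/andP; split.
    by apply/allP => z /(allP yt2); apply: leq_trans; apply: ltnW.
  apply/allP => z zt1 /=; rewrite (allP t1x z zt1) /=.
  by apply/allP => z' /(allP yt2) yz'; rewrite (leq_trans (allP t1x z zt1)) //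
    (leq_trans (ltnW xy)).
- move=> c; have := K c; have := K y; rewrite /count_le /count_lt !count_cat /=.
  have cr : y <= c -> count (fun z : 'I_n => z <= c) r = size r.
    move=> yc; apply/eqP; rewrite -all_count; apply/allP => z /ry zy.
    exact: leq_trans zy yc.
  have cry : count (fun z : 'I_n => z <= y) r = size r.
    by apply/eqP; rewrite -all_count; apply/allP => z /ry zy.
  have c1 b : x < b -> count (fun z : 'I_n => z < b) t1 = size t1.
    move=> xb; apply/eqP; rewrite -all_count; apply/allP => z /(allP t1x) zx.
    exact: leq_ltn_trans zx xb.
  have c2 : count (fun z : 'I_n => z < y) t2 = 0.
    apply/eqP; rewrite -leqn0 leqNgt -has_count; apply/hasPn => z /(allP yt2) yz.
    by rewrite -leqNgt.
  case: (leqP y c) => yc.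
    have xc : x < c by apply: leq_trans yc.
    rewrite cr // cry c2 !c1 // ltnn xc /=; lia.
  by case: (ltnP x c) => xc; rewrite ?(ltnNge y) ?(ltnW yc) /=; lia.
- move=> y' z x'; rewrite inE mem_cat inE => y'r zt x'v zy'.
  case/orP: zt => [zt1|/orP[/eqP->|zt2]].
  - by apply: leq_trans (allP t1x z zt1) _; apply: (allP xv).
  - by apply: (allP xv).
  - have := allP yt2 z zt2; case/orP: y'r => [/eqP <-|/ry y'y]; lia.
Qed.

Lemma bump_plactic st1 st2 : bump_inv st1 -> bump st1 st2 ->
  plactic (state_word st1) (state_word st2).
Proof.
move=> I1 B; case: B I1 => r t1 y t2 x v t1x xy yt2 [_ St _ _ _].
move: St; rewrite row_cat row_cons => /and3P[S1 /andP[_ S2] _].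
rewrite /state_word /= rev_cons -cats1 -!catA; apply: plactic_catl.
have := plactic_catr v (plactic_row_insert S1 S2 t1x xy yt2).
by rewrite /= -!catA /= -!catA.
Qed.

(** Insertion stops at the first letter that bumps nothing; in a row [v] no later letter bumps
    anything either. *)
Fixpoint run r t v : state :=
  if v is x :: v' then
    if [seq z : 'I_n <- t | x < z] is y :: t2 then
      run (y :: r) ([seq z : 'I_n <- t | z <= x] ++ x :: t2) v'
    else (r, t, v)
  else (r, t, v).

(** Reverse insertion: the last bumped [y] takes the place of the rightmost smaller letter of the
    row [t], which returns to the front of [v]. *)
Fixpoint unrun r t v : word * word :=
  if r is y :: r' then
    if rev [seq z : 'I_n <- t | z < y] is x :: t1 then
      unrun r' (rev t1 ++ y :: [seq z : 'I_n <- t | y <= z]) (x :: v)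
    else (t, v)
  else (t, v).

Lemma filter_all_id (p : pred 'I_n) u : all p u -> filter p u = u.
Proof. by move/all_filterP. Qed.

Lemma filter_all_nil (p : pred 'I_n) u : all (predC p) u -> filter p u = [::].
Proof. by rewrite all_predC has_filter negbK => /eqP. Qed.

Lemma run_bump st1 st2 : bump st1 st2 ->
  run st1.1.1 st1.1.2 st1.2 = run st2.1.1 st2.1.2 st2.2.
Proof.
case=> r t1 y t2 x v t1x xy yt2 /=; rewrite !filter_cat /= xy leqNgt xy /=.
rewrite (filter_all_nil (u := t1)) ?(filter_all_id t1x) /=; last first.
  by apply/allP => z /(allP t1x) /=; rewrite leqNgt.
rewrite (filter_all_nil (u := t2)) ?cats0; last first.
  by apply/allP => z /(allP yt2) /= yz; rewrite -ltnNge (leq_trans xy).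
by rewrite (filter_all_id (u := t2)) //; apply/allP => z /(allP yt2); apply: leq_trans.
Qed.

Lemma unrun_bump st1 st2 : bump st1 st2 ->
  unrun st2.1.1 st2.1.2 st2.2 = unrun st1.1.1 st1.1.2 st1.2.
Proof.
case=> r t1 y t2 x v t1x xy yt2 /=; rewrite !filter_cat /= xy leqNgt xy /=.
rewrite (filter_all_id (u := t1)); last first.
  by apply/allP => z /(allP t1x) zx; apply: leq_ltn_trans zx xy.
rewrite (filter_all_nil (u := t2)); last first.
  by apply/allP => z /(allP yt2) /=; rewrite leqNgt.
rewrite (filter_all_id yt2) (filter_all_nil (u := t1)).
  by rewrite cats1 rev_rcons revK.
by apply/allP => z /(allP t1x) zx /=; rewrite -ltnNge (leq_ltn_trans zx).
Qed.

Lemma bump_ex r t x v : row t -> ~~ all (fun z => z <= x) t ->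
  exists st, bump (r, t, x :: v) st.
Proof.
elim: t => [|a t IHt] // in v *; rewrite row_cons => /andP[at_ St].
case: (leqP a x) => [ax /= H|xa _].
  case: (IHt v St) => [|st B]; first by move: H; rewrite /= ax.
  inversion B as [r' t1 y t2 x' v' t1x xy yt2 E1 E2].
  exists (y :: r, (a :: t1) ++ x :: t2, v).
  by rewrite -[a :: (t1 ++ _)]cat_cons; apply: Bump => //=; rewrite ax.
by exists (a :: r, [::] ++ x :: t, v); apply: (@Bump r [::] a t x v).
Qed.

Lemma bump_unrun_ex y r t v : bump_inv (y :: r, t, v) ->
  exists2 st, bump st (y :: r, t, v) & bump_inv st.
Proof.
case=> Sr St Sv K J.
have [t1 [x [t2 [Et t1x xy yt2]]]] : exists t1 x t2,
   [/\ t = t1 ++ x :: t2, all (fun z => z <= x) t1, x < y & all (fun z => y <= z) t2].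
  (* At [c = y] the counting clause counts [y] itself on the left, so [t] has a letter below [y];
     the rightmost one is the letter to evict. *)
  have : 0 < count_lt y t by apply: leq_trans (K y); rewrite /count_le /= leqnn.
  move: St; elim/last_ind: t {K J} => [|t z IHt] //; rewrite -cats1 row_cat.
  case/and3P=> St _ tz; rewrite /count_lt count_cat /= addn0 => H.
  have [zy|yz] := ltnP z y.
    exists t, z, [::]; split=> //; apply/allP => a /(allP tz) /=.
    by rewrite andbT.
  case: IHt => // [|t1 [x [t2 [-> ? ? yt2]]]].
    by move: H; rewrite /count_lt; lia.
  by exists t1, x, (rcons t2 z); rewrite cats1 rcons_cat; split; rewrite // all_rcons yz.
subst t; exists (r, t1 ++ y :: t2, x :: v); first exact: Bump.
move: St Sr; rewrite row_cat row_cons rev_cons -cats1 row_cat.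
case/and3P=> S1 /andP[_ S2] S12 /and3P[Sr _ ry'].
have ry z : z \in r -> z <= y.
  by rewrite -mem_rev => /(allP ry') /=; rewrite andbT.
split=> //.
- rewrite row_cat row_cons S1 S2 yt2 /=; apply/allP => z /(allP t1x) zx /=.
  rewrite (leq_trans zx (ltnW xy)) /=; apply/allP => z' /(allP yt2).
  by apply: leq_trans; apply: leq_trans zx (ltnW xy).
- rewrite row_cons Sv andbT; apply/allP => z zv.
  by apply: (J y x z); rewrite ?mem_head // mem_cat mem_head orbT.
- move=> c; have := K c; have := K y; rewrite /count_le /count_lt !count_cat /=.
  have cr : count (fun z : 'I_n => z <= c) r <= size r by apply: count_size.
  have cry : count (fun z : 'I_n => z <= y) r = size r.
    by apply/eqP; rewrite -all_count; apply/allP => z /ry zy.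
  have c1 b : x < b -> count (fun z : 'I_n => z < b) t1 = size t1.
    move=> xb; apply/eqP; rewrite -all_count; apply/allP => z /(allP t1x) zx.
    exact: leq_ltn_trans zx xb.
  have c2 : count (fun z : 'I_n => z < y) t2 = 0.
    apply/eqP; rewrite -leqn0 leqNgt -has_count; apply/hasPn => z /(allP yt2) yz.
    by rewrite -leqNgt.
  rewrite (c1 y xy) cry c2 leqnn xy; case: (ltnP x c) => xc.
    by rewrite (c1 c xc); case: (leqP y c) => yc; case: (ltnP y c) => /=; lia.
  have -> : (y <= c) = false by move: xc xy; clear; lia.
  have -> : (y < c) = false by move: xc xy; clear; lia.
  by [].
- move=> y' z x' y'r; rewrite mem_cat !inE => zt x'v zy'.
  have y'y := ry _ y'r.
  case/orP: zt => [zt1|/orP[/eqP zy|zt2]].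
  - case/orP: x'v => [/eqP ->|x'v]; first exact: (allP t1x).
    apply: (J y z x'); rewrite ?mem_head // ?mem_cat ?zt1 //.
    exact: leq_trans zy' y'y.
  - by subst z; move: zy' y'y; clear; lia.
  - by have := allP yt2 z zt2; move: zy' y'y; clear; lia.
Qed.

Lemma bumps_trans st1 st2 st3 : bumps st1 st2 -> bumps st2 st3 -> bumps st1 st3.
Proof.
by move=> B12 B23; elim: B23 B12 => // ? ? ? _ IH B /IH B'; apply: bumps_step B' B.
Qed.

Lemma bumpsP st1 st2 : bumps st1 st2 -> bump_inv st1 ->
  [/\ bump_inv st2, plactic (state_word st1) (state_word st2),
      size st2.1.2 = size st1.1.2 & size st2.1.1 + size st2.2 = size st1.1.1 + size st1.2]
  /\ run st1.1.1 st1.1.2 st1.2 = run st2.1.1 st2.1.2 st2.2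
  /\ unrun st2.1.1 st2.1.2 st2.2 = unrun st1.1.1 st1.1.2 st1.2.
Proof.
elim=> {st1 st2} [st I|st1 st2 st3 _ IH B /IH[[I2 P2 s2 s2'] [-> <-]]].
  by split=> //; split=> //; apply: plactic_refl.
rewrite (run_bump B) (unrun_bump B); split=> //; split.
- exact: bump_invP B.
- exact: plactic_trans P2 (bump_plactic I2 B).
- by rewrite -s2; case: B => *; rewrite /= !size_cat.
- by rewrite -s2'; case: B => *; rewrite /= addSnnS.
Qed.

Lemma run_settled r t v : row (t ++ v) -> run r t v = (r, t, v).
Proof.
case: v => [|x v] //=; rewrite row_cat => /and3P[_ _ tx].
rewrite filter_all_nil //; apply/allP => z /(allP tx) /= /andP[zx _].
by rewrite -leqNgt.
Qed.

Lemma run_ex r t v : bump_inv (r, t, v) ->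
  exists2 st, bumps (r, t, v) st & settled st.
Proof.
elim: v r t => [|x v IHv] r t I.
  by exists (r, t, [::]); [apply: bumps_refl|rewrite /settled /= cats0; case: I].
have [_ St Sv _ _] := I.
have [tx|ntx] := boolP (all (fun z => z <= x) t).
  exists (r, t, x :: v); [exact: bumps_refl|rewrite /settled row_cat St Sv /=].
  apply/allP => z /(allP tx) zx /=; rewrite zx /=.
  have := Sv; rewrite -/(row (x :: v)) row_cons => /andP[/allP xv _].
  by apply/allP => z' /xv; apply: leq_trans.
have [st B] := bump_ex r v St ntx.
have := bump_invP I B; have B' := B.
inversion B as [r' t1 y t2 x' v' t1x xy yt2 E1 E2]; subst; move=> I'.
have [st' B1 B2] := IHv _ _ I'; exists st' => //.
by apply: bumps_trans B1; apply: bumps_step (bumps_refl _) B'.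
Qed.

Lemma unrun_ex r t v : bump_inv (r, t, v) ->
  exists2 p, bumps ([::], p.1, p.2) (r, t, v) & bump_inv ([::], p.1, p.2).
Proof.
elim: r t v => [|y r IHr] t v I; first by exists (t, v) => //; apply: bumps_refl.
have [st B I'] := bump_unrun_ex I.
inversion B as [r' t1 y' t2 x v' t1x xy yt2 E1 E2]; subst.
have [p B1 I1] := IHr _ _ I'; exists p => //.
exact: bumps_step B1 B.
Qed.

Lemma bump_inv0 u v : bump_inv ([::], u, v) <-> row u /\ row v.
Proof. by split=> [[]|[]]. Qed.

Lemma count_lt_take c k s : row s -> count_lt c (take k s) = minn k (count_lt c s).
Proof.
elim: s k => [|x s IHs] [|k] //= Ss; rewrite ?minn0 ?min0n //.
have := Ss; rewrite -/(row (x :: s)) row_cons => /andP[xs Ss'].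
have := IHs k Ss'; rewrite /count_lt /= => ->.
case: (ltnP x c) => xc /=; first by rewrite !add1n minnSS.
have -> : count (fun z : 'I_n => z < c) s = 0; last by rewrite minn0 minn0.
apply/eqP; rewrite -leqn0 leqNgt -has_count; apply/hasPn => z /(allP xs) xz.
by rewrite -leqNgt (leq_trans xc).
Qed.

(** A prefix of length [k] keeps the smaller of [k] and the number of letters below [c], enough for
    the counting clause once [size r <= k]. The last clause holds because the whole bottom row is
    sorted. *)
Lemma bump_inv_resplit r t v k : bump_inv (r, t, v) -> row (t ++ v) -> size r <= k ->
  bump_inv (r, take k (t ++ v), drop k (t ++ v)).
Proof.
move=> [Sr St Sv K J] S rk.
have := S; rewrite -{1}(cat_take_drop k (t ++ v)) row_cat => /and3P[S1 S2 S12].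
split=> // [c|y z x _ zt xv _]; last by apply: (allP (allP S12 z zt)).
rewrite count_lt_take // leq_min (leq_trans _ rk) ?count_size //=.
by rewrite (leq_trans (K c)) // /count_lt count_cat leq_addr.
Qed.

Lemma bump_inv_size r t v : bump_inv (r, t, v) -> size r <= size t.
Proof.
case=> _ _ _ /(_ n) K _; apply: leq_trans (count_size (fun z : 'I_n => z < n) t).
apply: leq_trans K; rewrite -[X in X <= _](count_predT r) leq_eqVlt; apply/orP; left.
by apply/eqP/eq_count => z /=; rewrite ltnW.
Qed.

(** The combinatorial R-matrix for two single rows. *)
Definition row_swap (p : word * word) : word * word :=
  let: (r, t, v) := run [::] p.1 p.2 in
  unrun r (take (size p.2) (t ++ v)) (drop (size p.2) (t ++ v)).

(** A pair and its image insert to the same two-row tableau and differ only in the cut of its bottom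
    row; cutting at the old place again gives the inverse. *)
Lemma row_swapP u v : row u -> row v -> let p := row_swap (u, v) in
  [/\ row p.1 /\ row p.2, plactic (u ++ v) (p.1 ++ p.2),
      size p.1 = size v, size p.2 = size u & row_swap p = (u, v)].
Proof.
move=> Su Sv; have I0 : bump_inv ([::], u, v) by apply/bump_inv0.
have [[[r t] w] B S] := run_ex I0; rewrite /settled /= in S.
have [[I1 P1 /= st sr] [R1 U1]] := bumpsP B I0; rewrite add0n /= in sr R1 U1.
set s := t ++ w in S *; rewrite /row_swap /= R1 run_settled //= -/s.
have I2 : bump_inv (r, take (size v) s, drop (size v) s).
  by apply: bump_inv_resplit => //; rewrite -sr leq_addr.
have [[u' v'] B' I0'] := unrun_ex I2.
have [[_ P2 st' sr'] [R2 U2]] := bumpsP B' I0'; rewrite add0n /= in st' sr' R2 U2.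
have /bump_inv0[Su' Sv'] := I0'.
have ss : size s + size r = size u + size v.
  by rewrite /s size_cat st -sr; lia.
have su' : size u' = size v.
  by rewrite -st' size_take; have := bump_inv_size I1; case: ltnP => //; lia.
have sv' : size v' = size u.
  by rewrite -sr' size_drop; have := bump_inv_size I1; lia.
rewrite U2 /=; split=> //.
  apply: plactic_trans P1 _; apply: plactic_sym; move: P2.
  by rewrite /state_word /= cat_take_drop.
rewrite R2 run_settled ?cat_take_drop //= sv'.
by rewrite -st take_size_cat // drop_size_cat // U1.
Qed.

End RowSwap.

(** * Parenthesis matching on two consecutive letters *)

Section Transducers.
Variables (n : nat) (lo hi : 'I_n).
Hypothesis hiE : hi = lo.+1 :> nat.
Local Notation word := (seq 'I_n).
Implicit Types (x y z : 'I_n) (u v w : word).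

(* Read each hi as an opening and each lo as a closing parenthesis, d counting
   the parentheses that are still open: raise turns the unmatched lo into hi.
   Recording d makes raise invertible, with inverse lower. *)
Fixpoint raise (d : nat) w : nat * word :=
  if w is x :: w' then
    if x == hi then let p := raise d.+1 w' in (p.1, x :: p.2)
    else if x == lo then
      if d is d'.+1 then let p := raise d' w' in (p.1, x :: p.2)
      else let p := raise 0 w' in (p.1, hi :: p.2)
    else let p := raise d w' in (p.1, x :: p.2)
  else (d, [::]).

(** The word is read from the right, [s] parentheses being open at its end. A [hi] after which none
    is open cannot be an opening parenthesis, so it is a raised [lo]. *)
Fixpoint lower (s : nat) w : nat * word :=
  if w is x :: w' then
    let p := lower s w' in
    if x == hi then (if p.1 is s'.+1 then (s', x :: p.2) else (0, lo :: p.2))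
    else if x == lo then (p.1.+1, x :: p.2)
    else (p.1, x :: p.2)
  else (s, [::]).

Variant letter_spec x : bool -> bool -> Prop :=
| LetterHi of x = hi : letter_spec x true false
| LetterLo of x = lo : letter_spec x false true
| LetterElse of x <> lo :> nat & x <> hi :> nat : letter_spec x false false.

Lemma letterP x : letter_spec x (x == hi) (x == lo).
Proof.
case: (eqVneq x hi) => [->|xhi].
  have -> : (hi == lo) = false by apply/eqP => /(congr1 val) /=; lia.
  exact: LetterHi.
case: (eqVneq x lo) => [->|xlo]; first exact: LetterLo.
by apply: LetterElse; apply/eqP.
Qed.

Lemma eq_lohi : (lo == hi) = false.
Proof. by apply/eqP => /(congr1 val) /=; lia. Qed.

Lemma lower_raise d w : lower (raise d w).1 (raise d w).2 = (d, w).
Proof.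
elim: w d => [|x w IHw] d //=.
case: (letterP x) => [->|->|ne1 ne2] /=.
- by rewrite IHw eqxx.
- by case: d => [|d] /=; rewrite IHw ?eqxx ?eq_lohi //=.
- by rewrite IHw; case: letterP => //= xE; rewrite xE in ne1 ne2.
Qed.

Lemma raise_lower s w : raise (lower s w).1 (lower s w).2 = (s, w).
Proof.
elim: w s => [|x w IHw] s //=.
have := IHw s; case: (lower s w) => e w' /= E.
case: (letterP x) => [->|->|ne1 ne2] /=.
- by case: e E => [|e] E /=; rewrite ?eqxx ?eq_lohi /= E.
- by rewrite eq_lohi eqxx /= E.
- by case: letterP => //= [xE|xE|_ _]; rewrite ?E //; rewrite xE in ne1 ne2.
Qed.

Lemma raise_cat d u v : raise d (u ++ v) =
  ((raise (raise d u).1 v).1, (raise d u).2 ++ (raise (raise d u).1 v).2).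
Proof.
elim: u d => [|x u IHu] d /=; first by case: (raise d v).
by case: letterP => [_|_|_ _]; [|case: d => [|d]|]; rewrite IHu.
Qed.

Lemma lower_cat s u v : lower s (u ++ v) =
  ((lower (lower s v).1 u).1, (lower (lower s v).1 u).2 ++ (lower s v).2).
Proof.
elim: u => [|x u IHu] /=; first by case: (lower s v).
rewrite IHu /=; case: letterP => [_|_|_ _] //=.
by case: (lower (lower s v).1 u) => [[|e] w].
Qed.

Local Ltac knuth := solve
  [ exact: plactic_refl | apply: plactic_yxz; lia | apply: plactic_xzy; lia
  | apply: plactic_sym; apply: plactic_yxz; lia
  | apply: plactic_sym; apply: plactic_xzy; lia ].

(** Contexts only change the counter at which the middle factor starts. For the elementary
    relations, all positions of the three letters relative to [lo] and [hi] are checked: the images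
    are equal or again elementarily related. *)
Lemma raise_plactic u v d : plactic u v ->
  (raise d u).1 = (raise d v).1 /\ plactic (raise d u).2 (raise d v).2.
Proof.
move=> uv; elim: uv d => {u v} [u|u v _ IH|v u w _ IH1 _ IH2|l r u v _ IH|x y z H|x y z H] d.
- by split=> //; apply: plactic_refl.
- by have [-> H] := IH d; split=> //; apply: plactic_sym.
- have [-> H1] := IH1 d; have [-> H2] := IH2 d; split=> //.
  exact: plactic_trans H1 H2.
- rewrite !raise_cat /=; have [-> H] := IH (raise d l).1.
  by split=> //; apply: plactic_ctx.
- rewrite /=; case: (letterP x) => *; case: (letterP y) => *; case: (letterP z) => *;
  subst; try (exfalso; lia); case: d => [|[|d]] /=; split=> //; knuth.
- rewrite /=; case: (letterP x) => *; case: (letterP y) => *; case: (letterP z) => *;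
  subst; try (exfalso; lia); case: d => [|[|d]] /=; split=> //; knuth.
Qed.

Lemma lower_plactic u v s : plactic u v ->
  (lower s u).1 = (lower s v).1 /\ plactic (lower s u).2 (lower s v).2.
Proof.
move=> uv; elim: uv s => {u v} [u|u v _ IH|v u w _ IH1 _ IH2|l r u v _ IH|x y z H|x y z H] s.
- by split=> //; apply: plactic_refl.
- by have [-> H] := IH s; split=> //; apply: plactic_sym.
- have [-> H1] := IH1 s; have [-> H2] := IH2 s; split=> //.
  exact: plactic_trans H1 H2.
- rewrite !lower_cat /=; have [E H] := IH (lower s r).1; rewrite E; split=> //.
  exact: plactic_ctx.
- rewrite /=; case: (letterP x) => *; case: (letterP y) => *; case: (letterP z) => *;
  subst; try (exfalso; lia); case: s => [|[|s]] /=; split=> //; knuth.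
- rewrite /=; case: (letterP x) => *; case: (letterP y) => *; case: (letterP z) => *;
  subst; try (exfalso; lia); case: s => [|[|s]] /=; split=> //; knuth.
Qed.

End Transducers.

(** * Column words of keys *)

Section KeyWord.
Variable n : nat.
Local Notation word := (seq 'I_n).
Implicit Types (x y z : 'I_n) (u v w : word) (a : 'I_n -> nat).

Definition key_col a j : word := [seq x <- enum 'I_n | j < a x].
(** Columns beyond the largest entry of [a] are empty, so one large [h] serves all rearrangements of
    [a]. *)
Definition key_word a h : word := flatten [seq rev (key_col a j) | j <- iota 0 h].

Lemma ltn_ord_trans : transitive (fun x y : 'I_n => x < y).
Proof. by move=> y x z; apply: ltn_trans. Qed.

Lemma enum_ord_sorted : sorted (fun x y : 'I_n => x < y) (enum 'I_n).
Proof. by have := iota_ltn_sorted 0 n; rewrite -val_enum_ord sorted_map. Qed.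

(** The columns are nested, so those containing [x] are the leftmost ones. *)
Lemma mem_nested_column x (T : seq word) j :
  sorted (fun C D : word => all (fun x => x \in C) D) T ->
  (x \in nth [::] T j) = (j < count (fun C : word => x \in C) T).
Proof.
have tr : transitive (fun C D : word => all (fun x => x \in C) D).
  by move=> D C E /allP CD /allP DE; apply/allP => y /DE /CD.
elim: T j => [|C T IHT] j /=; first by rewrite nth_nil ltn0.
move=> pT; case: j => [|j] /=; last rewrite IHT ?(path_sorted pT) //.
  have [xC|xC] := boolP (x \in C); first by [].
  apply/esym/negbTE; rewrite -eqn0Ngt add0n -leqn0 leqNgt -has_count.
  apply/hasPn => D DT; apply: contra xC; apply: (allP _).
  exact: (allP (order_path_min tr pT)).
have [xC|xC] := boolP (x \in C); first by rewrite add1n ltnS.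
have -> : count (fun C : word => x \in C) T = 0; last by [].
apply/eqP; rewrite -leqn0 leqNgt -has_count.
apply/hasPn => D DT; apply: contra xC; apply: (allP _).
exact: (allP (order_path_min tr pT)).
Qed.

Lemma key_wordP (a : 'X_{1..n}) : exists2 h, forall x, a x <= h &
  column_word (key a) = key_word a h.
Proof.
have /andP[/andP[/and3P[_ /allP sT _] nT] /eqP wT] := xchooseP (key_ex a).
rewrite -/(key a) in sT nT wT; set T := key a in sT nT wT *.
have aE x : a x = count (fun C : word => x \in C) T.
  rewrite -wT mnmE count_flatten -sum1_count big_mkcond sumnE big_map /=.
  apply: eq_big_seq => C /sT sC; rewrite count_uniq_mem //.
  exact: sorted_uniq ltn_ord_trans (fun x => ltnn x) C sC.
exists (size T) => [x|]; first by rewrite aE count_size.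
rewrite /column_word /key_word; congr flatten.
rewrite -[in LHS](mkseq_nth [::] T) -map_comp; apply/eq_in_map => j.
rewrite mem_iota add0n => /andP[_ jT] /=; congr rev.
apply: (irr_sorted_eq ltn_ord_trans (fun x : 'I_n => ltnn x)).
- exact/sT/mem_nth.
- exact/(sorted_filter ltn_ord_trans)/enum_ord_sorted.
by move=> x; rewrite mem_filter mem_enum andbT mem_nested_column // aE.
Qed.

Section Lower.
Variables lo hi : 'I_n.
Hypothesis hiE : hi = lo.+1 :> nat.

Lemma enum_ord_split : exists A B, enum 'I_n = A ++ lo :: hi :: B.
Proof.
have sE := enum_ord_sorted; have : lo \in enum 'I_n by rewrite mem_enum.
have : hi \in enum 'I_n by rewrite mem_enum.
move=> + loE; move: sE; case/splitPr: loE => A B.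
rewrite (sorted_pairwise ltn_ord_trans) pairwise_cat /= allrel_consr -andbA.
case/and4P=> /allP Alo _ _ /andP[/allP loB pB].
rewrite mem_cat inE => /or3P[/Alo|/eqP|]; first by rewrite hiE ltnNge leqnSn.
  by move/(congr1 val)=> /=; rewrite hiE => /eqP; rewrite -addn1 -{2}[val lo]addn0 eqn_add2l.
case: B loB pB => [|y B] // loB /= /andP[/allP yB _]; rewrite inE.
case/orP=> [/eqP ->|/yB]; first by exists A, B.
by have := loB y (mem_head _ _); rewrite hiE ltnS => /leq_trans H /H; rewrite ltnn.
Qed.

Lemma lower_id s u : lo \notin u -> hi \notin u -> lower lo hi s u = (s, u).
Proof.
elim: u => [|x u IHu] //=; rewrite !inE !negb_or => /andP[xlo ulo] /andP[xhi uhi].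
by rewrite IHu //= eq_sym (negbTE xhi) eq_sym (negbTE xlo).
Qed.

Lemma lower_mid m m' u v : lower lo hi 0 m = (0, m') ->
  lo \notin u -> hi \notin u -> lo \notin v -> hi \notin v ->
  lower lo hi 0 (u ++ m ++ v) = (0, u ++ m' ++ v).
Proof. by move=> Em *; rewrite !lower_cat // !(lower_id 0 (u := v)) //= Em /= lower_id. Qed.

Lemma lower_key_col (P P' : pred 'I_n) : (P lo -> P hi) ->
  P' lo = P hi -> P' hi = P lo -> (forall x, x != lo -> x != hi -> P' x = P x) ->
  lower lo hi 0 (rev [seq x <- enum 'I_n | P x]) = (0, rev [seq x <- enum 'I_n | P' x]).
Proof.
move=> Plh Plo Phi Pne; have [A [B E]] := enum_ord_split.
have : uniq (enum 'I_n) by apply: enum_uniq.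
rewrite E cat_uniq /= !inE !negb_or -!andbA => /and5P[_ loA hiA _ /and4P[lohi loB hiB _]].
have sub (C : seq 'I_n) (Q : pred 'I_n) z : z \notin C -> z \notin rev (filter Q C).
  by move=> zC; rewrite mem_rev mem_filter negb_and zC orbT.
have eqC C : lo \notin C -> hi \notin C -> filter P' C = filter P C.
  move=> loC hiC; apply: eq_in_filter => x xC; apply: Pne.
    by apply: contraNneq loC => <-.
  by apply: contraNneq hiC => <-.
have rev3 Q : rev (filter Q (A ++ lo :: hi :: B)) =
    rev (filter Q B) ++ rev (filter Q [:: lo; hi]) ++ rev (filter Q A).
  by rewrite -[lo :: hi :: B]/([:: lo; hi] ++ B) !filter_cat !rev_cat -catA.
rewrite !rev3 -!(eqC A) // -!(eqC B) //; apply: lower_mid; rewrite ?sub //=.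
rewrite Plo Phi; case: (P lo) Plh => [->//|_]; case: (P hi); rewrite /= ?eqxx //=.
all: by rewrite ?(eq_lohi hiE) ?eqxx.
Qed.

Lemma lower_key_word (a a' : 'I_n -> nat) h : a lo <= a hi ->
  a' lo = a hi -> a' hi = a lo -> (forall x, x != lo -> x != hi -> a' x = a x) ->
  lower lo hi 0 (key_word a h) = (0, key_word a' h).
Proof.
move=> le_a alo ahi ane; rewrite /key_word.
elim: (iota 0 h) => [|j s IHs] //=; rewrite lower_cat // IHs /=.
rewrite (@lower_key_col _ (fun x => j < a' x)) ?alo ?ahi //.
  by move=> jl; apply: leq_trans le_a.
by move=> x xl xh; rewrite ane.
Qed.

End Lower.
(** The letter [z] passes each [y] of [w] because the letter just before [y] is strictly above [y]
    and at most [z]. *)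
Lemma plactic_insert_top x z w : sorted (fun x y : 'I_n => y < x) (x :: w) -> x <= z ->
  plactic (x :: w ++ [:: z]) (x :: z :: w).
Proof.
elim: w x => [|y w IHw] x /=; first by move=> _ _; apply: plactic_refl.
case/andP=> yx sw xz.
have yz : y <= z by apply: leq_trans (ltnW yx) xz.
apply: plactic_trans (plactic_cons x (IHw y sw yz)) _.
by apply: (@plactic_catr _ w [:: x; y; z] [:: x; z; y]); apply: plactic_yxz; rewrite yx.
Qed.

Lemma plactic_absorb_nseq x w k : sorted (fun x y : 'I_n => y < x) (x :: w) ->
  plactic (x :: w ++ nseq k x) (x :: nseq k x ++ w).
Proof.
move=> sw; elim: k => [|k IHk] /=; first by rewrite cats0; apply: plactic_refl.
rewrite -[w ++ _]/(w ++ [:: x] ++ nseq k x) catA.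
have H := plactic_catr (nseq k x) (plactic_insert_top sw (leqnn x)).
exact: plactic_trans H (plactic_cons x IHk).
Qed.

(** [L] decreases and [P] is closed upward, so the column is an initial segment of [L]. The block of
    its top letter moves left past the rest of the column, which is then absorbed recursively. *)
Lemma plactic_absorb_column (P : pred 'I_n) (p : 'I_n -> nat) (L : word) :
  sorted (fun x y : 'I_n => y < x) L -> (forall x y, x < y -> P x -> P y) ->
  plactic (filter P L ++ flatten [seq nseq (p x) x | x <- L])
    (flatten [seq nseq (P x + p x) x | x <- L]).
Proof.
move=> sL upP; have tr : transitive (fun x y : 'I_n => y < x).
  by move=> y x z yx zy; apply: ltn_trans yx.
elim: L sL => [|x L IHL] /= sL; first exact: plactic_refl.
have /allP xL := order_path_min tr sL.
case Px: (P x) => /=; last first.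
  have PL y : y \in L -> P y = false.
    by move=> /xL yx; apply: contraFF Px; apply: upP.
  rewrite (eq_in_filter (a2 := pred0)) ?filter_pred0 //=.
  apply: plactic_catl; rewrite -[X in plactic X]cat0s.
  have := IHL (path_sorted sL).
  by rewrite (eq_in_filter (a2 := pred0)) ?filter_pred0.
apply: (@plactic_trans _ (x :: nseq (p x) x ++ filter P L ++ flatten [seq nseq (p y) y | y
  <- L])).
  rewrite catA [X in plactic _ (_ :: X)]catA -!cat_cons; apply: plactic_catr.
  apply: plactic_absorb_nseq.
  by have /= := @sorted_filter _ _ tr P (x :: L) sL; rewrite Px.
exact: plactic_cons (plactic_catl _ (IHL (path_sorted sL))).
Qed.

(** For weakly increasing [a] each column is an upper set of the alphabet, so adding columns from
    right to left merges them into blocks of equal letters. *)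
Lemma plactic_key_row (a : 'I_n -> nat) h : (forall x y, x < y -> a x <= a y) ->
  (forall x, a x <= h) ->
  plactic (key_word a h) (flatten [seq nseq (a x) x | x <- rev (enum 'I_n)]).
Proof.
move=> mono_a ah.
have sL : sorted (fun x y : 'I_n => y < x) (rev (enum 'I_n)).
  by rewrite rev_sorted enum_ord_sorted.
have -> : flatten [seq nseq (a x) x | x <- rev (enum 'I_n)] =
    flatten [seq nseq (count (fun j => j < a x) (iota 0 h)) x | x <- rev (enum 'I_n)].
  congr flatten; apply: eq_map => x; congr nseq.
  rewrite -(subnKC (ah x)) iotaD count_cat add0n.
  rewrite (eq_in_count (a2 := predT)) => [|j]; last by rewrite mem_iota.
  rewrite count_predT size_iota (eq_in_count (a2 := pred0)) ?count_pred0 ?addn0 //.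
  by move=> j; rewrite mem_iota => /andP[aj _]; rewrite /= ltnNge aj.
rewrite /key_word; elim: (iota 0 h) => [|j s IHs] /=.
  rewrite (_ : flatten _ = [::]); first exact: plactic_refl.
  by elim: (rev _).
apply: plactic_trans (plactic_catl _ IHs) _.
rewrite /key_col -filter_rev; apply: plactic_absorb_column => // x y xy.
by move/leq_trans; apply; apply: mono_a.
Qed.

End KeyWord.

(** * Biwords *)

Section Biwords.
Variable n : nat.
Local Notation word := (seq 'I_n).
Local Notation biword := (seq ('I_n * 'I_n)).
Local Notation row := (sorted (fun x y : 'I_n => x <= y)).
Implicit Types (x y : 'I_n) (u v w : word) (z A C : biword).

Definition placticb u v : bool :=
  (size u == size v) && knuth_equiv (insubd (in_tuple v) u) (in_tuple v).

Lemma placticP u v : reflect (plactic u v) (placticb u v).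
Proof.
have E : size u = size v -> val (insubd (in_tuple v) u) = u.
  by move=> suv; rewrite insubdK //; apply/eqP.
apply: (iffP andP) => [[/eqP suv /knuth_equivP]|uv]; first by rewrite E.
have suv := perm_size (plactic_perm uv).
by rewrite suv eqxx; split=> //; apply/knuth_equivP; rewrite E.
Qed.

Definition lex_le : rel ('I_n * 'I_n) :=
  fun p q => (p.1 < q.1) || ((p.1 == q.1) && (p.2 <= q.2)).

Lemma lex_le_trans : transitive lex_le.
Proof.
move=> [b1 b2] [a1 a2] [c1 c2]; rewrite /lex_le /= -!val_eqE /=; lia.
Qed.

(** Letters are counted from 0, so the flag bound n + 1 becomes a strict bound by [n]. *)
Definition flagged : pred ('I_n * 'I_n) := fun p => p.1 + p.2 < n.

Section Relabel.
Variables lo hi : 'I_n.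
Hypothesis hiE : hi = lo.+1 :> nat.

Definition raise_letter d x := if (x == lo) && (d == 0) then hi else x.
Definition raise_count d x := if x == hi then d.+1 else if x == lo then d.-1 else d.
Definition lower_letter s x := if (x == hi) && (s == 0) then lo else x.
Definition lower_count s x := if x == hi then s.-1 else if x == lo then s.+1 else s.

Lemma raise_cons d x u : raise lo hi d (x :: u) =
  ((raise lo hi (raise_count d x) u).1,
   raise_letter d x :: (raise lo hi (raise_count d x) u).2).
Proof.
rewrite /= /raise_letter /raise_count.
by case: (letterP hiE x) => [->|->|_ _]; rewrite ?(eq_lohi hiE) ?eqxx //; case: d.
Qed.

Lemma lower_cons s x u : lower lo hi s (x :: u) =
  (lower_count (lower lo hi s u).1 x,
   lower_letter (lower lo hi s u).1 x :: (lower lo hi s u).2).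
Proof.
rewrite /= /lower_letter /lower_count; case: (letterP hiE x) => [->|->|_ _] //=.
by case: (lower lo hi s u) => [[|e] w].
Qed.

Lemma size_raise d u : size (raise lo hi d u).2 = size u.
Proof. by elim: u d => [|x u IHu] d //; rewrite raise_cons /= IHu. Qed.

Lemma size_lower s u : size (lower lo hi s u).2 = size u.
Proof. by elim: u => [|x u IHu] //; rewrite lower_cons /= IHu. Qed.

Definition raise_biword d z := zip (unzip1 z) (raise lo hi d (unzip2 z)).2.
Definition lower_biword s z := zip (unzip1 z) (lower lo hi s (unzip2 z)).2.

Lemma raise_biword_cons d p z : raise_biword d (p :: z) =
  (p.1, raise_letter d p.2) :: raise_biword (raise_count d p.2) z.
Proof. by rewrite /raise_biword /unzip2 map_cons raise_cons. Qed.

Lemma lower_biword_cons s p z : lower_biword s (p :: z) =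
  (p.1, lower_letter (lower lo hi s (unzip2 z)).1 p.2) :: lower_biword s z.
Proof. by rewrite /lower_biword /unzip2 map_cons lower_cons. Qed.

Lemma raise_biwordE d z : (unzip1 (raise_biword d z) = unzip1 z) *
  (unzip2 (raise_biword d z) = (raise lo hi d (unzip2 z)).2).
Proof. by split; rewrite ?unzip1_zip ?unzip2_zip ?size_raise ?size_map. Qed.

Lemma lower_biwordE s z : (unzip1 (lower_biword s z) = unzip1 z) *
  (unzip2 (lower_biword s z) = (lower lo hi s (unzip2 z)).2).
Proof. by split; rewrite ?unzip1_zip ?unzip2_zip ?size_lower ?size_map. Qed.

(** In a row the [lo] form a block. Its first letters close the open parentheses, so the raised ones
    end the block and the row stays sorted. *)
Lemma raise_biword_sorted d z : sorted lex_le z -> sorted lex_le (raise_biword d z).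
Proof.
elim: z d => [|p [|q z] IHz] d; rewrite ?raise_biword_cons //= => /andP[pq pz].
move: (IHz (raise_count d p.2) pz); rewrite !raise_biword_cons /= => ->.
rewrite andbT; move: pq; rewrite /lex_le /= -!val_eqE /= /raise_letter /raise_count.
case: (letterP hiE p.2) => [->|->|? ?]; case: (letterP hiE q.2) => [->|->|? ?] /=;
 case: d => [|[|d]] //=; lia.
Qed.

Lemma lower_biword_sorted s z : sorted lex_le z -> sorted lex_le (lower_biword s z).
Proof.
elim: z => [|p z IHz] //; rewrite lower_biword_cons => pz.
have := IHz (path_sorted pz); case: z pz {IHz} => [|q z] // /andP[pq _].
rewrite lower_biword_cons {2}/unzip2 map_cons -/(unzip2 z) lower_cons /= => ->.
rewrite andbT; move: pq.
rewrite /lex_le /= -!val_eqE /= /lower_letter /lower_count.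
case: (letterP hiE p.2) => [->|->|? ?]; case: (letterP hiE q.2) => [->|->|? ?] /=;
 case: (lower lo hi s (unzip2 z)).1 => [|[|d]] //=; lia.
Qed.

Variables i0 i1 : 'I_n.
Hypotheses (i1E : i1 = i0.+1 :> nat) (hi_i0 : hi + i0 = n.-1).

Definition relaxed : pred ('I_n * 'I_n) := fun p => flagged p || (p == (i1, hi)).

(** Raising adds 1 to a letter, so a flag fails by at most one; as [hi + i1] equals [n], this
    happens only in row [i1]. *)
Lemma raise_biword_relaxed d z : all flagged z -> all relaxed (raise_biword d z).
Proof.
elim: z d => [|[w x] z IHz] d //= /andP[wx zf]; rewrite raise_biword_cons /= IHz // andbT.
move: wx; rewrite /relaxed /flagged /raise_letter /=.
case: (letterP hiE x) => [->|->|? ?] /=; try by move=> ->.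
case: d => [|d] /=; last by move=> ->.
rewrite xpair_eqE eqxx andbT -val_eqE /=; have := ltn_ord i0; lia.
Qed.

Lemma lower_pos u : 0 < (lower lo hi 0 u).1 -> lo \in u.
Proof.
elim: u => [|x u IHu] //; rewrite lower_cons /= /lower_count inE.
by case: (letterP hiE x) => [->|->|? ?] /=; rewrite ?eqxx // => H; rewrite IHu ?orbT //; lia.
Qed.

Lemma lower_biword_flagged z : sorted lex_le z -> all relaxed z ->
  all flagged (lower_biword 0 z).
Proof.
elim: z => [|[w x] z IHz] // pz /andP[wx zr].
rewrite lower_biword_cons /= IHz ?(path_sorted pz) // andbT.
case/orP: wx => [|/eqP[wE xE]]; last subst w x; rewrite /flagged /lower_letter /=.
  by case: (letterP hiE x) => [->|->|_ _] //=; case: ifP => _ //; rewrite hiE addnS => /ltnW.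
rewrite eqxx /=; case: eqP => [_|/eqP]; first by have := ltn_ord i0; lia.
(* A [hi] in row [i1] that is not lowered has a [lo] after it. This [lo] cannot lie in the sorted
   row [i1], and in a later row it breaks the flag. *)
rewrite -lt0n => /lower_pos/mapP[[w' y] qz /= yE]; rewrite -{}yE in qz.
have := allP (order_path_min lex_le_trans pz) _ qz; have := allP zr _ qz.
rewrite /relaxed /flagged /lex_le /= xpair_eqE -!val_eqE /=.
have := ltn_ord i0; lia.
Qed.

End Relabel.
End Biwords.

Arguments lex_le {n}.
Arguments flagged {n}.

Lemma sorted_filter_cat (T : Type) (e : rel T) (Q : pred T) (s : seq T) :
  transitive e -> sorted e s -> (forall x y, e x y -> Q y -> Q x) ->
  s = filter Q s ++ filter (predC Q) s.
Proof.
move=> tr + dQ; elim: s => [|x s IHs] //= ps.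
have E := IHs (path_sorted ps); case Qx: (Q x) => /=; first by rewrite -E.
have F t : all (e x) t -> filter Q t = [::].
  by elim: t => //= y t IHt /andP[xy /IHt]; rewrite (contraFF (dQ _ _ xy) Qx).
by rewrite {1}E F // (order_path_min tr ps).
Qed.

(** Length-preserving bijections of lists are carried to tuples; as the sizes agree, [insubd]
    returns the given list and not its default. *)
Lemma sum_tuple_bij (V : nmodType) (T : finType) (p : nat) (A B : pred (seq T))
    (f g : seq T -> seq T) (F G : seq T -> V) :
  (forall s, A s -> [/\ B (f s), g (f s) = s, size (f s) = size s & F s = G (f s)]) ->
  (forall s, B s -> [/\ A (g s), f (g s) = s & size (g s) = size s]) ->
  (\sum_(s : p.-tuple T | A s) F s = \sum_(s : p.-tuple T | B s) G s)%R.
Proof.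
move=> HA HB.
have vE (s s' : p.-tuple T) t : size t = size s' -> val (insubd s t) = t.
  by move=> st; rewrite insubdK // unfold_in st size_tuple.
rewrite (reindex_onto (fun s : p.-tuple T => insubd s (g s))
                      (fun s : p.-tuple T => insubd s (f s))); last first.
  move=> s /HA[Bs gf sf _]; apply: val_inj.
  have [_ _ sg] := HB _ Bs.
  by rewrite (vE _ s) (vE _ s) // gf.
apply: eq_big => s.
  apply/andP/idP => [[As /eqP sE]|Bs].
    by have [Bs _ sf _] := HA _ As; rewrite -sE (vE _ _ _ sf).
  have [As fg sg] := HB _ Bs; have [_ _ sf _] := HA _ As.
  by split; rewrite (vE _ _ _ sg) //; apply/eqP/val_inj; rewrite (vE _ s) ?fg.
move=> /andP[As /eqP sE]; have [Bs _ sf ->] := HA _ As.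
by rewrite -[in RHS]sE (vE _ _ _ sf).
Qed.

(** * Two consecutive rows of a biword *)

Section SwapRows.
Variable n : nat.
Local Notation word := (seq 'I_n).
Local Notation biword := (seq ('I_n * 'I_n)).
Local Notation row := (sorted (fun x y : 'I_n => x <= y)).
Implicit Types (x y : 'I_n) (u v w : word) (z A C : biword).
Variables (i0 i1 : 'I_n).
Hypothesis i1E : i1 = i0.+1 :> nat.

Definition rows_below z := [seq p : 'I_n * 'I_n <- z | p.1 < i0].
Definition rows_above z := [seq p : 'I_n * 'I_n <- z | i1 < p.1].
Definition biword_row (i : 'I_n) z := [seq p.2 | p <- z & p.1 == i].
Definition join_rows A u v C := A ++ map (pair i0) u ++ map (pair i1) v ++ C.

Lemma map_pair_row i z : map (pair i) (biword_row i z) = [seq p <- z | p.1 == i].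
Proof.
rewrite -map_comp -[RHS]map_id; apply/eq_in_map => -[w x].
by rewrite mem_filter /= => /andP[/eqP ->].
Qed.

Lemma join_rowsE z : sorted lex_le z ->
  join_rows (rows_below z) (biword_row i0 z) (biword_row i1 z) (rows_above z) = z.
Proof.
move=> sz; rewrite /join_rows !map_pair_row /rows_below /rows_above.
have tr := @lex_le_trans n.
have dQ k (p q : 'I_n * 'I_n) : lex_le p q -> q.1 < k -> p.1 < k.
  by rewrite /lex_le -val_eqE /=; lia.
have E1 := sorted_filter_cat tr sz (dQ i0).
set z1 := filter (predC _) z in E1; have sz1 : sorted lex_le z1 by apply: sorted_filter.
have E2 := sorted_filter_cat tr sz1 (dQ i0.+1).
set z2 := filter (predC _) z1 in E2; have sz2 : sorted lex_le z2 by apply: sorted_filter.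
rewrite [RHS]E1 E2 (sorted_filter_cat tr sz2 (dQ i1.+1)) /z2 /z1 -!filter_predI.
by congr (_ ++ (_ ++ (_ ++ _))); apply: eq_filter => p; rewrite /= -?val_eqE /=; lia.
Qed.

Lemma filter_map_pair (Q : pred 'I_n) i u :
  [seq p <- map (pair i) u | Q p.1] = if Q i then map (pair i) u else [::].
Proof. by rewrite filter_map; case: ifP => Qi; rewrite (eq_filter (a2 := fun=> Q i)) //
  Qi ?filter_predT ?filter_pred0. Qed.

Lemma map_snd_pair (i : 'I_n) w : map snd (map (pair i) w) = w.
Proof. by rewrite -map_comp map_id. Qed.

Section Parts.
Variables (A C : biword) (u v : word).
Hypotheses (Alt : all (fun p : 'I_n * 'I_n =>
  p.1 < i0) A) (Cgt : all (fun p : 'I_n * 'I_n => i1 < p.1) C).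

Lemma join_rows_filter (Q : pred 'I_n) (a c : bool) :
  (forall i : 'I_n, i < i0 -> Q i = a) -> (forall i : 'I_n, i1 < i -> Q i = c) ->
  [seq p <- join_rows A u v C | Q p.1] = (if a then A else [::])
    ++ (if Q i0 then map (pair i0) u else [::])
    ++ (if Q i1 then map (pair i1) v else [::]) ++ (if c then C else [::]).
Proof.
move=> Qa Qc; rewrite !filter_cat !filter_map_pair; congr (_ ++ _); last congr (_ ++ (_ ++ _)).
  case: a Qa => Qa; [apply/all_filterP|apply/eqP;
    rewrite -[_ == _]negbK -has_filter -all_predC].
    by apply/allP => p /(allP Alt) /Qa.
  by apply/allP => p /(allP Alt) /Qa /= ->.
case: c Qc => Qc; [apply/all_filterP|apply/eqP; rewrite -[_ == _]negbK -has_filter -all_predC].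
  by apply/allP => p /(allP Cgt) /Qc.
by apply/allP => p /(allP Cgt) /Qc /= ->.
Qed.

Lemma rows_below_join : rows_below (join_rows A u v C) = A.
Proof.
rewrite /rows_below (@join_rows_filter (fun i : 'I_n => i < i0) true false) => [|i|i].
- by rewrite ltnn ltnNge i1E leqnSn /= cats0.
- by [].
- by move=> ii; apply/negbTE; lia.
Qed.

Lemma rows_above_join : rows_above (join_rows A u v C) = C.
Proof.
rewrite /rows_above (@join_rows_filter (fun i : 'I_n => i1 < i) false true) => [|i|i] //.
- by rewrite ltnn ltnNge i1E leqnSn.
- by move=> ii; apply/negbTE; lia.
Qed.

Lemma biword_row0_join : biword_row i0 (join_rows A u v C) = u.
Proof.
rewrite /biword_row (@join_rows_filter (pred1 i0) false false) => [|i|i] /=.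
- have -> : (i1 == i0) = false by rewrite -val_eqE /=; lia.
  by rewrite eqxx !cats0 /= map_snd_pair.
- by rewrite -val_eqE /=; lia.
- by rewrite -val_eqE /=; lia.
Qed.

Lemma biword_row1_join : biword_row i1 (join_rows A u v C) = v.
Proof.
rewrite /biword_row (@join_rows_filter (pred1 i1) false false) => [|i|i] /=.
- have -> : (i0 == i1) = false by rewrite -val_eqE /=; lia.
  by rewrite eqxx !cats0 /= map_snd_pair.
- by rewrite -val_eqE /=; lia.
- by rewrite -val_eqE /=; lia.
Qed.

Lemma join_rows_sorted : sorted lex_le (join_rows A u v C) =
  [&& sorted lex_le A, row u, row v & sorted lex_le C].
Proof.
have tr := @lex_le_trans n.
have mE i w : pairwise lex_le (map (pair i) w) = row w.
  rewrite pairwise_map (sorted_pairwise (@row_leq_trans n)).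
  by apply: eq_pairwise => x y; rewrite /lex_le /= ltnn eqxx.
have lt (p q : 'I_n * 'I_n) : p.1 < q.1 -> lex_le p q by move=> H; rewrite /lex_le H.
rewrite !(sorted_pairwise tr) !pairwise_cat !mE !allrel_catr.
have -> : allrel lex_le A (map (pair i0) u).
  by apply/allrelP => p q /(allP Alt) pi /mapP[x _ ->]; apply: lt.
have -> : allrel lex_le A (map (pair i1) v).
  by apply/allrelP => p q /(allP Alt) pi /mapP[x _ ->]; apply: lt => /=; lia.
have -> : allrel lex_le A C.
  by apply/allrelP => p q /(allP Alt) pi /(allP Cgt) qi; apply: lt => /=; lia.
have -> : allrel lex_le (map (pair i0) u) (map (pair i1) v).
  by apply/allrelP => p q /mapP[x _ ->] /mapP[y _ ->]; apply: lt => /=; lia.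
have -> : allrel lex_le (map (pair i0) u) C.
  by apply/allrelP => p q /mapP[x _ ->] /(allP Cgt) qi; apply: lt => /=; lia.
have -> // : allrel lex_le (map (pair i1) v) C.
by apply/allrelP => p q /mapP[x _ ->] /(allP Cgt) qi; apply: lt.
Qed.

(** The flag bounds row [i0] by [hi], and relaxing row [i1] raises its bound to [hi] too. This
    common bound is what lets the two rows be exchanged. *)
Lemma join_rows_relaxed (hi : 'I_n) : hi + i0 = n.-1 ->
  all (relaxed hi i1) (join_rows A u v C) =
  [&& all (relaxed hi i1) A, all (fun x => x <= hi) u, all (fun x => x <= hi) v
    & all (relaxed hi i1) C].
Proof.
move=> hi_i0; rewrite !all_cat !all_map; congr [&& _, _, _ & _]; apply: eq_all => x.
  by rewrite /relaxed /flagged /= xpair_eqE -!val_eqE /=; have := ltn_ord i0; lia.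
by rewrite /relaxed /flagged /= xpair_eqE -!val_eqE /=; have := ltn_ord i0; lia.
Qed.

Lemma join_rows_letters : unzip2 (join_rows A u v C) = unzip2 A ++ u ++ v ++ unzip2 C.
Proof. by rewrite /unzip2 !map_cat -!map_comp !map_id. Qed.

Lemma join_rows_comp k : word_comp (unzip1 (join_rows A u v C)) k =
  count_mem k (unzip1 A) + (i0 == k) * size u + (i1 == k) * size v
  + count_mem k (unzip1 C).
Proof.
rewrite mnmE /unzip1 !map_cat !count_cat -!map_comp !count_map !addnA.
congr (_ + _ + _ + _).
  by rewrite (eq_count (a2 := fun=> i0 == k)) //; case: eqP => _;
    rewrite ?count_predT ?count_pred0 ?mul1n.
by rewrite (eq_count (a2 := fun=> i1 == k)) //; case: eqP => _;
  rewrite ?count_predT ?count_pred0 ?mul1n.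
Qed.

End Parts.
End SwapRows.

Section SwapBiword.
Variable n : nat.
Local Notation word := (seq 'I_n).
Local Notation biword := (seq ('I_n * 'I_n)).
Local Notation row := (sorted (fun x y : 'I_n => x <= y)).
Implicit Types (x y : 'I_n) (u v w K : word) (z A C : biword).
Variables (i0 i1 lo hi : 'I_n).
Hypotheses (i1E : i1 = i0.+1 :> nat) (hiE : hi = lo.+1 :> nat).
Hypothesis hi_i0 : hi + i0 = n.-1.

(** [R] will either be trivial or ask for a [hi] in row [i1]. *)
Definition biword_mem K (R : rel word) z :=
  [&& sorted lex_le z, all (relaxed hi i1) z, placticb (unzip2 z) K
    & R (biword_row i0 z) (biword_row i1 z)].

Variables (R : rel word) (phi : word * word -> word * word) (e : nat).
Hypothesis phiP : forall u v, row u -> row v ->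
    all (fun x => x <= hi) u -> all (fun x => x <= hi) v -> R u v ->
  let p := phi (u, v) in
  [/\ row p.1 /\ row p.2, plactic (u ++ v) (p.1 ++ p.2), R p.1 p.2, phi p = (u, v)
    & size p.1 + e = size v /\ size p.2 = size u + e].

Definition swap_rows z :=
  let p := phi (biword_row i0 z, biword_row i1 z) in
  join_rows i0 i1 (rows_below i0 z) p.1 p.2 (rows_above i1 z).

(** Only one factor of the letter word changes, and within its Knuth class. Counting row [i0] with
    [e] extra letters makes the exchange of lengths exact. *)
Lemma swap_rowsP K z : biword_mem K R z ->
  [/\ biword_mem K R (swap_rows z), swap_rows (swap_rows z) = z,
      size (swap_rows z) = size z
    & forall k, (word_comp (unzip1 (swap_rows z)) + U_(i0) *+ e)%MM k =
                (word_comp (unzip1 z) + U_(i0) *+ e)%MM (tperm i0 i1 k)].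
Proof.
case/and4P=> sz; have zE := join_rowsE i1E sz; move: sz.
have Alt : all (fun p : 'I_n * 'I_n => p.1 < i0) (rows_below i0 z) by apply: filter_all.
have Cgt : all (fun p : 'I_n * 'I_n => i1 < p.1) (rows_above i1 z) by apply: filter_all.
rewrite /swap_rows; move: Alt Cgt zE.
move: (rows_below i0 z) (rows_above i1 z) (biword_row i0 z) (biword_row i1 z).
move=> A C u v Alt Cgt <-.
rewrite (join_rows_sorted i1E) // (join_rows_relaxed i1E) // join_rows_letters.
case/and4P=> sA su sv sC /and4P[rA uhi vhi rC] /placticP pK Ruv.
have := phiP su sv uhi vhi Ruv; case: (phi (u, v)) => u' v' /=.
case=> [[su' sv'] p' Ruv' phi' [sz_u' sz_v']].
have E := (rows_below_join i1E, rows_above_join i1E, biword_row0_join i1E, biword_row1_join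
  i1E).
rewrite /biword_mem !E // phi'; split=> //.
- rewrite (join_rows_sorted i1E) // (join_rows_relaxed i1E) // join_rows_letters.
  rewrite sA su' sv' sC rA rC Ruv' !andbT /=.
  have : all (fun x => x <= hi) (u' ++ v').
    by rewrite -(perm_all _ (plactic_perm p')) all_cat uhi.
  rewrite all_cat => /andP[-> ->] /=; apply/placticP.
  apply: plactic_trans pK; apply: plactic_catl; rewrite !catA.
  exact/plactic_catr/plactic_sym.
- rewrite /join_rows !size_cat !size_map; move: sz_u' sz_v'; clear.
  by move=> H ->; rewrite -H; lia.
have i10 : (i1 == i0) = false by rewrite -val_eqE /= i1E gtn_eqF.
have cnt0 (B : biword) k (P : pred 'I_n) : all (fun p : 'I_n * 'I_n => P p.1) B ->
  ~~ P k -> count_mem k (unzip1 B) = 0.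
  move=> /allP PB Pk; apply/count_memPn; apply: contra Pk => /mapP[p pB ->].
  exact: PB.
have cA0 : count_mem i0 (unzip1 A) = 0 by apply: (cnt0 _ _ (fun i => i < i0)); rewrite // ltnn.
have cA1 : count_mem i1 (unzip1 A) = 0 by apply: (cnt0 _ _ (fun i => i < i0)); rewrite //
  -leqNgt i1E.
have cC0 : count_mem i0 (unzip1 C) = 0 by apply: (cnt0 _ _ (fun i => i1 < i)); rewrite //
  -leqNgt i1E.
have cC1 : count_mem i1 (unzip1 C) = 0 by apply: (cnt0 _ _ (fun i => i1 < i)); rewrite // ltnn.
move=> k; rewrite !mnmDE !mulmnE !mnm1E !join_rows_comp.
case: tpermP => [->|->|/eqP k0 /eqP k1].
- rewrite cA0 cA1 cC0 cC1 !eqxx i10 (eq_sym i0) i10.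
  by move: sz_u' sz_v'; clear; move=> H1 H2; rewrite -?H1 ?H2; lia.
- rewrite cA0 cA1 cC0 cC1 !eqxx i10 (eq_sym i0) i10.
  by move: sz_u' sz_v'; clear; move=> H1 H2; rewrite -?H1 ?H2; lia.
- by rewrite !(eq_sym _ k) (negbTE k0) (negbTE k1).
Qed.

Lemma sum_biword_sym K p :
  let S := (\sum_(z : p.-tuple ('I_n * 'I_n) | biword_mem K R z)
              'X_[(word_comp (unzip1 z) + U_(i0) *+ e)%MM] : {mpoly int[n]})%R in
  msym (tperm i0 i1) S = S.
Proof.
move=> S; rewrite {1}/S raddf_sum /=.
pose wt z : 'X_{1..n} := (word_comp (unzip1 z) + U_(i0) *+ e)%MM.
apply: (@sum_tuple_bij _ _ p _ _ swap_rows swap_rows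
  (fun z => msym (tperm i0 i1) 'X_[wt z]) (fun z => 'X_[wt z])%R) => z zK.
  have [H1 H2 H3 H4] := swap_rowsP zK; split=> //.
  rewrite msymX; congr mpolyX; apply/mnmP => k.
  by rewrite H4 mnmE tpermV.
by have [H1 H2 H3 H4] := swap_rowsP zK.
Qed.

End SwapBiword.

(** * The recursion *)

Section Step.
Variable n : nat.
Local Notation word := (seq 'I_n).
Local Notation biword := (seq ('I_n * 'I_n)).
Local Notation row := (sorted (fun x y : 'I_n => x <= y)).
Implicit Types (x y : 'I_n) (u v w K : word) (z : biword).

Lemma row_swap_memP (hi : 'I_n) u v : row u -> row v ->
    all (fun x => x <= hi) u -> all (fun x => x <= hi) v ->
  let p := row_swap (u, v) in
  [/\ row p.1 /\ row p.2, plactic (u ++ v) (p.1 ++ p.2), true, row_swap p = (u, v)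
    & size p.1 + 0 = size v /\ size p.2 = size u + 0].
Proof.
by move=> su sv _ _; have [? ? ? ? ?] := row_swapP su sv; split; rewrite // !addn0.
Qed.

(* v ends with the maximal letter hi, which can be appended to any row. *)
Definition row_swap_rcons (hi : 'I_n) (p : word * word) :=
  let q := row_swap (p.1, take (size p.2).-1 p.2) in (q.1, rcons q.2 hi).

Lemma row_rcons_max (hi : 'I_n) v : all (fun x => x <= hi) v -> row v -> row (rcons v hi).
Proof.
move=> vhi sv; rewrite -cats1 row_cat sv /=.
by apply/allP => x /(allP vhi) /= ->.
Qed.

Lemma row_last_max (hi : 'I_n) v : row v -> all (fun x => x <= hi) v -> hi \in v ->
  v = rcons (take (size v).-1 v) hi.
Proof.
case/lastP: v => [|v x] // sv; rewrite all_rcons => /andP[xhi vhi].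
rewrite mem_rcons inE size_rcons -cats1 take_size_cat // cats1.
case/orP=> [/eqP <- //|hv]; congr rcons; apply: val_inj; apply/eqP.
rewrite eqn_leq xhi /=; move: sv; rewrite -cats1 row_cat => /and3P[_ _].
by move=> /allP/(_ _ hv) /=; rewrite andbT.
Qed.

(** The final [hi] stays at the end of the second row while the rest of [v] is exchanged with [u];
    hence the shift by 1 in the lengths. *)
Lemma row_swap_rconsP (hi : 'I_n) u v : row u -> row v ->
    all (fun x => x <= hi) u -> all (fun x => x <= hi) v -> hi \in v ->
  let p := row_swap_rcons hi (u, v) in
  [/\ row p.1 /\ row p.2, plactic (u ++ v) (p.1 ++ p.2), hi \in p.2,
     row_swap_rcons hi p = (u, v)
    & size p.1 + 1 = size v /\ size p.2 = size u + 1].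
Proof.
move=> su sv uhi vhi hv; move: (row_last_max sv vhi hv).
move: (take _ v) => v0 vE; subst v; move: vhi; rewrite all_rcons => /andP[_ v0hi].
have sv0 : row v0 by move: sv; rewrite -cats1 row_cat => /andP[].
rewrite /row_swap_rcons /= size_rcons -[in take _ _]cats1 take_size_cat //.
have := row_swapP su sv0; case: (row_swap (u, v0)) => u' v' /=.
case=> [[su' sv'] p' s1 s2 E].
have : all (fun x => x <= hi) (u' ++ v').
  by rewrite -(perm_all _ (plactic_perm p')) all_cat uhi.
rewrite all_cat => /andP[_ v'hi]; split.
- by split=> //; apply: row_rcons_max.
- by rewrite -!rcons_cat -!cats1; apply: plactic_catr.
- by rewrite mem_rcons mem_head.
- by rewrite size_rcons -[rcons v' hi]cats1 take_size_cat // E.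
- by rewrite !size_rcons s1 s2 !addn1.
Qed.

Local Open Scope ring_scope.

(** This is H(a) when [K] is the column word of key(a) and [p] its length. *)
Definition key_sum p K : {mpoly int[n]} :=
  \sum_(z : p.-tuple ('I_n * 'I_n) |
      [&& sorted lex_le z, all flagged z & placticb (unzip2 z) K])
    'X_[word_comp (unzip1 z)].

Lemma msym_tpermX (x y k : 'I_n) :
  msym (tperm x y) ('X_k : {mpoly int[n]}) = 'X_(tperm x y k).
Proof.
rewrite msymX; congr mpolyX; apply/mnmP => j; rewrite !mnmE tpermV.
by congr (nat_of_bool _); apply/eqP/eqP => [->|<-]; rewrite tpermK.
Qed.

Lemma subX_neq0 (x y : 'I_n) : x != y -> ('X_x - 'X_y : {mpoly int[n]}) != 0.
Proof.
move=> xy; apply/eqP => /(congr1 (fun f => f@_U_(x))).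
rewrite mcoeffB !mcoeffX mcoeff0 eqxx (_ : U_(y) == U_(x) = false)%MM //.
apply/eqP => /mnmP/(_ x); rewrite !mnm1E eqxx eq_sym (negbTE xy).
by [].
Qed.

Lemma pos_neq (i : 'I_n.-1) : pos0 i != pos1 i.
Proof. by rewrite -val_eqE /= neq_ltn ltnSn. Qed.

Lemma demazure_uniq (i : 'I_n.-1) (f g : {mpoly int[n]}) :
  g * ('X_(pos0 i) - 'X_(pos1 i)) =
    'X_(pos0 i) * f - msym (simple_tperm i) ('X_(pos0 i) * f) ->
  demazure i f = g.
Proof.
move=> H; have /eqP := xchooseP (divdiff_ex i ('X_(pos0 i) * f)).
by rewrite -H => /(mulIf (subX_neq0 (pos_neq i))).
Qed.

Lemma key_sum_step (i : 'I_n.-1) p (a a' : 'I_n -> nat) h :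
    (a (rev_ord (pos1 i)) <= a (rev_ord (pos0 i)))%N ->
    (forall x, a' x = a (rev_ord (simple_tperm i (rev_ord x)))) ->
  demazure i (key_sum p (key_word a h)) = key_sum p (key_word a' h).
Proof.
set i0 := pos0 i; set i1 := pos1 i; set lo := rev_ord i1; set hi := rev_ord i0.
move=> le_a a'E; set K := key_word a h; set K' := key_word a' h.
have i1E : i1 = i0.+1 :> nat by [].
have hiE : hi = lo.+1 :> nat by rewrite /hi /lo /= subnSK // pos1_subproof.
have hi_i0 : (hi + i0 = n.-1)%N by have := ltn_ord i0; rewrite /hi /=; lia.
have low : lower lo hi 0 K = (0, K').
  apply: lower_key_word => //; rewrite ?a'E ?rev_ordK /simple_tperm.
  - by rewrite tpermR.
  - by rewrite tpermL.
  - move=> x xlo xhi; rewrite a'E tpermD ?rev_ordK //.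
      by apply: contra_neq xhi => E; rewrite /hi /i0 E rev_ordK.
    by apply: contra_neq xlo => E; rewrite /lo /i1 E rev_ordK.
have rai : raise lo hi 0 K' = (0, K).
  by have := raise_lower hiE 0 K; rewrite low.
(* [g] runs over the relaxed biwords of the class of [K]; [r], the h of the idea, keeps those with a
   [hi] in row [i1], necessarily at its end. *)
pose g : {mpoly int[n]} := \sum_(z : p.-tuple ('I_n * 'I_n) |
  biword_mem i0 i1 hi K (fun _ _ => true) z) 'X_[word_comp (unzip1 z)].
pose r : {mpoly int[n]} := \sum_(z : p.-tuple ('I_n * 'I_n) |
  biword_mem i0 i1 hi K (fun _ v => hi \in v) z) 'X_[word_comp (unzip1 z)].
have -> : key_sum p K' = g.
  pose X z : {mpoly int[n]} := 'X_[word_comp (unzip1 z)].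
  rewrite /key_sum /g; symmetry.
  (* Knuth equivalence carries the final counter 0 from [K] and [K'] to every word of their classes,
     so lowering and raising from 0 are mutually inverse. *)
  apply: (@sum_tuple_bij _ _ _ (biword_mem i0 i1 hi K (fun _ _ => true))
    (fun z => [&& sorted lex_le z, all flagged z & placticb (unzip2 z) K']) (lower_biword
      lo hi 0) (raise_biword lo hi 0) X X).
    move=> z /and4P[sz rz /placticP pz _].
    have [l1 l2] := lower_plactic hiE 0 pz; rewrite low /= in l1 l2.
    split; last by rewrite /X (lower_biwordE hiE).
    - rewrite (lower_biword_sorted hiE) // (lower_biword_flagged hiE i1E hi_i0) //=.
      by apply/placticP; rewrite (lower_biwordE hiE).
    - rewrite /raise_biword !(lower_biwordE hiE).
      by have := raise_lower hiE 0 (unzip2 z); rewrite l1 => ->; apply: zip_unzip.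
    - by rewrite /lower_biword size_zip (size_lower hiE) !size_map minnn.
  move=> z /and3P[sz fz /placticP pz].
  have [l1 l2] := raise_plactic hiE 0 pz; rewrite rai /= in l1 l2.
  split.
  - rewrite /biword_mem (raise_biword_sorted hiE) //
    (raise_biword_relaxed hiE i1E hi_i0) //= andbT.
    by apply/placticP; rewrite (raise_biwordE hiE).
  - rewrite /lower_biword !(raise_biwordE hiE).
    by have := lower_raise hiE 0 (unzip2 z); rewrite l1 => ->; apply: zip_unzip.
  - by rewrite /raise_biword size_zip (size_raise hiE) !size_map minnn.
have gE : g = key_sum p K + r.
  rewrite /g (bigID (fun z : p.-tuple _ => all flagged z)) /=; congr (_ + _).
    apply: eq_bigl => z; rewrite /biword_mem andbT.
    have [fz|] := boolP (all flagged z); last by rewrite !andbF.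
    have -> : all (relaxed hi i1) z.
      by apply/allP => q /(allP fz) qf; rewrite /relaxed qf.
    by rewrite andbT.
  apply: eq_bigl => z; rewrite /biword_mem andbT.
  case: (sorted _ _) => //=; have [rz|//] := boolP (all (relaxed hi i1) z).
  rewrite /=; congr (_ && _); rewrite -has_predC.
  (* [(i1, hi)] is the only relaxed pair that is not flagged. *)
  have nf : ~~ flagged (i1, hi) by rewrite /flagged /= -leqNgt; lia.
  apply/hasP/mapP => [[q qz /= qf]|[[w x]]].
    exists q; last by have := allP rz _ qz; rewrite /relaxed (negbTE qf) => /eqP ->.
    rewrite mem_filter qz andbT; have := allP rz _ qz.
    by rewrite /relaxed (negbTE qf) => /eqP ->; rewrite eqxx.
  rewrite mem_filter /= => /andP[/eqP -> xz] xE; exists (i1, x) => //=.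
  by rewrite -xE.
have g_sym : msym (simple_tperm i) g = g.
  have := @sum_biword_sym n i0 i1 hi i1E hi_i0 (fun _ _ => true) (@row_swap n) 0.
  move=> /(_ (fun u v su sv uh vh _ => row_swap_memP su sv uh vh) K p) /=.
  by rewrite (eq_bigr (fun z : p.-tuple _ => 'X_[word_comp (unzip1 z)])) // => z _;
    rewrite mulm0n addm0.
have r_sym : msym (simple_tperm i) ('X_i0 * r) = 'X_i0 * r.
  have := @sum_biword_sym n i0 i1 hi i1E hi_i0 (fun _ v => hi \in v) (row_swap_rcons hi) 1.
  move=> /(_ (@row_swap_rconsP hi) K p) /=.
  have -> // : 'X_i0 * r = \sum_(z : p.-tuple ('I_n * 'I_n) |
     biword_mem i0 i1 hi K (fun _ v =>
       hi \in v) z) 'X_[(word_comp (unzip1 z) + U_(i0) *+ 1)%MM].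
  by rewrite mulr_sumr; apply: eq_bigr => z _; rewrite mulm1n mpolyXD mulrC.
apply: demazure_uniq; rewrite -/i0 -/i1.
(* As [g] and ['X_i0 * r] are symmetric, [r] cancels in the numerator of the divided difference,
   leaving [('X_i0 - 'X_i1) * g]. *)
have -> : key_sum p K = g - r by rewrite gE addrK.
rewrite (mulrBr _ g r) msymB r_sym msymM g_sym msym_tpermX tpermL -/i1.
ring.
Qed.

End Step.

(** * Weakly increasing compositions *)

Section Base.
Variable n : nat.
Local Notation word := (seq 'I_n).
Local Notation biword := (seq ('I_n * 'I_n)).
Local Notation row := (sorted (fun x y : 'I_n => x <= y)).
Implicit Types (x y : 'I_n) (u v w K : word) (z : biword) (a : 'I_n -> nat).

Lemma eq_key_word a a' h : a =1 a' -> key_word a h = key_word a' h.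
Proof.
move=> E; congr flatten; apply: eq_map => j; congr rev.
by apply: eq_filter => x /=; rewrite E.
Qed.

Lemma sum_ltn_iota m h : m <= h -> \sum_(j <- iota 0 h) (j < m) = m.
Proof.
move=> mh; rewrite -(subnKC mh) iotaD big_cat /= add0n.
rewrite (eq_big_seq (fun=> 1)) => [|j]; last by rewrite mem_iota => /andP[_ ->].
rewrite sum1_size size_iota big_seq big1 ?addn0 // => j.
by rewrite mem_iota => /andP[mj _]; rewrite ltnNge mj.
Qed.

Lemma size_key_word a h : (forall x, a x <= h) -> size (key_word a h) = \sum_x a x.
Proof.
move=> ah; rewrite size_flatten sumnE big_map big_map.
under eq_bigr => j _.
  rewrite size_rev size_filter -sum1_count big_mkcond big_enum /=.
  over.
rewrite exchange_big /=; apply: eq_bigr => x _.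
by rewrite -[RHS](sum_ltn_iota (ah x)); apply: eq_bigr => j _; case: ltnP.
Qed.

Lemma lower_ge (lo hi : 'I_n) s u : hi = lo.+1 :> nat -> hi \notin u ->
  s <= (lower lo hi s u).1.
Proof.
move=> hiE; elim: u => [|x u IHu] //; rewrite lower_cons // inE negb_or eq_sym /=.
move=> /andP[xhi /IHu]; rewrite /lower_count (negbTE xhi).
by case: ifP => // _ /leqW.
Qed.

(** Read from the right, [lo] makes the counter positive, and only a [hi] to its left can bring it
    down again. *)
Lemma lower_prefix (lo hi : 'I_n) u v : hi = lo.+1 :> nat ->
  (lower lo hi 0 (u ++ lo :: v)).1 = 0 -> hi \in u.
Proof.
move=> hiE; apply: contra_eqT => hu; rewrite lower_cat // lower_cons //=.
rewrite -lt0n; apply: leq_trans (lower_ge _ hiE hu).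
by rewrite /lower_count (eq_lohi hiE) eqxx.
Qed.

Definition antidiagonal : pred ('I_n * 'I_n) := fun p => p.2 == rev_ord p.1.

Lemma biword_antidiagonal a h z : (forall x y, x < y -> a x <= a y) ->
  sorted lex_le z -> all flagged z -> plactic (unzip2 z) (key_word a h) ->
  all antidiagonal z.
Proof.
move=> mono_a sz fz pz; suff H z1 z2 : z = z1 ++ z2 -> all antidiagonal z1.
  by apply: (H z [::]); rewrite cats0.
elim/last_ind: z1 z2 => [|z1 [w d] IH] z2 // zE.
have dz1 : all antidiagonal z1 by apply: (IH ((w, d) :: z2)); rewrite -cat_rcons.
rewrite all_rcons dz1 andbT /antidiagonal /=.
have wd : w + d < n.
  by apply: (allP fz (w, d)); rewrite zE mem_cat mem_rcons mem_head.
apply/eqP/val_inj => /=; apply/eqP; case: (eqVneq (d : nat) (n - w.+1)) => // ne.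
have hd : d.+1 < n by lia.
pose hi := Ordinal hd.
have hiE : hi = d.+1 :> nat by [].
have adh : a d <= a hi by apply: mono_a.
pose a' x := a (tperm d hi x).
have low : lower d hi 0 (key_word a h) = (0, key_word a' h).
  apply: lower_key_word; rewrite /a' ?tpermL ?tpermR // => x xd xhi.
  by rewrite tpermD // eq_sym.
(* The key word has counter 0, hence so do the letters of [z]: a letter [d + 1] precedes this
   [d]. *)
have [+ _] := lower_plactic hiE 0 pz; rewrite low zE cat_rcons /unzip2 map_cat /=.
move=> /(lower_prefix hiE)/mapP[[w' y] wz1 /= yE]; subst y.
(* With rows counted from 0, that letter lies on the antidiagonal in row n - 2 - d, which is at
   least [w], against the lexicographic order. *)
have := allP dz1 _ wz1 => /eqP /(congr1 val) /= hw'.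
move: sz; rewrite zE (sorted_pairwise (@lex_le_trans n)) pairwise_cat => /and3P[_ + _].
rewrite -cats1 pairwise_cat => /and3P[/allrelP/(_ _ (w, d) wz1 (mem_head _ _)) + _ _].
rewrite /lex_le /= -val_eqE /=; have := ltn_ord w'; lia.
Qed.

Lemma map_rev_ord_enum : map (@rev_ord n) (enum 'I_n) = rev (enum 'I_n).
Proof.
apply: (irr_sorted_eq (leT := fun x y : 'I_n => y < x)).
- by move=> y x z yx zy; apply: ltn_trans yx.
- by move=> x; apply: ltnn.
- rewrite sorted_map; apply: sub_sorted (enum_ord_sorted n) => x y /= xy.
  by have := ltn_ord y; lia.
- by rewrite rev_sorted; apply: enum_ord_sorted.
by move=> x; rewrite mem_rev mem_enum -[x]rev_ordK map_f // mem_enum.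
Qed.

Lemma row_nseq (b : 'I_n -> nat) (L : word) : sorted (fun x y : 'I_n => x < y) L ->
  row (flatten [seq nseq (b x) x | x <- L]).
Proof.
elim: L => [|x L IHL] //= pL; rewrite row_cat IHL ?(path_sorted pL) //=.
apply/andP; split; first by elim: (b x) => [|[|k] IHk] //=; rewrite leqnn.
apply/allP => y /nseqP[-> _]; apply/allP => y' /flattenP[s /mapP[x' x'L ->]] /nseqP[-> _].
by apply: ltnW; apply: (allP (order_path_min (@ltn_ord_trans n) pL)).
Qed.

Lemma key_sum_base p a h : (forall x y, x < y -> a x <= a y) -> (forall x, a x <= h) ->
  p = \sum_x a x ->
  key_sum p (key_word a h) = 'X_[[multinom a (rev_ord i) | i < n]].
Proof.
move=> mono_a ah pE.
(* The first components of the only term: all copies of the letter [rev_ord x] are forced into row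
   [x]. *)
pose w0 := flatten [seq nseq (a (rev_ord x)) x | x <- enum 'I_n].
pose dg x : 'I_n * 'I_n := (x, rev_ord x).
have w0_letters : map (@rev_ord n) w0 = flatten [seq nseq (a x) x | x <- rev (enum 'I_n)].
  rewrite -map_rev_ord_enum map_flatten -!map_comp; congr flatten.
  by apply: eq_map => w /=; rewrite map_nseq.
have sw0 : row w0 by apply/row_nseq/enum_ord_sorted.
have sdg w : sorted lex_le (map dg w) = row w.
  rewrite sorted_map; apply: eq_sorted => x y /=.
  by rewrite /lex_le /= -val_eqE /=; lia.
have pw0 : plactic (map (@rev_ord n) w0) (key_word a h).
  by rewrite w0_letters; apply/plactic_sym/plactic_key_row.
have szw0 : size (map dg w0) == p.
  by rewrite size_map -(size_map (@rev_ord n)) (perm_size (plactic_perm pw0)) size_key_word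
    // pE.
rewrite /key_sum (big_pred1 (Tuple szw0)) => [|z].
  congr mpolyX; apply/mnmP => i; rewrite !mnmE /= /unzip1 -map_comp map_id.
  rewrite count_flatten -map_comp sumnE big_map big_enum /= (bigD1 i) //=.
  rewrite count_nseq /= eqxx mul1n big1 ?addn0 // => j ji.
  by rewrite count_nseq /= (negbTE ji).
rewrite [RHS]/= -val_eqE /=; apply/and3P/eqP => [[sz fz /placticP pz]|->].
  have az := biword_antidiagonal mono_a sz fz pz.
  have zE : val z = map dg (unzip1 z).
    rewrite /unzip1 -map_comp -[LHS]map_id; apply/eq_in_map => -[w d] /(allP az).
    by rewrite /antidiagonal /dg /= => /eqP ->.
  have zE2 : unzip2 z = map (@rev_ord n) (unzip1 z) by rewrite zE /unzip2 /unzip1 -!map_comp.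
  rewrite zE; congr map; apply: (sorted_eq (@row_leq_trans n)) => //.
  - by move=> x y /anti_leq /val_inj.
  - by rewrite -sdg -zE.
  apply: (perm_map_inj (@rev_ord_inj n)); rewrite -zE2.
  by apply: perm_trans (plactic_perm pz) _; rewrite perm_sym; apply: plactic_perm.
split; first by rewrite sdg.
  by apply/allP => q /mapP[w _ ->]; rewrite /flagged /=; have := ltn_ord w; lia.
by apply/placticP; rewrite /unzip2 -map_comp.
Qed.

End Base.

(** * Ascents and reduced words *)

Section Inversions.
Variable n : nat.
Implicit Types (b : 'I_n -> nat) (i : 'I_n.-1) (x y : 'I_n).

(** Their number is the length of the shortest permutation sorting [b] into weakly decreasing
    order. *)
Definition ascents b : {set 'I_n * 'I_n} :=
  [set p : 'I_n * 'I_n | (p.1 < p.2) && (b p.1 < b p.2)].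

Lemma simple_tperm_ltn i x y : x < y -> (x, y) != (pos0 i, pos1 i) ->
  simple_tperm i x < simple_tperm i y.
Proof.
rewrite xpair_eqE -!val_eqE /=; rewrite /simple_tperm.
case: tpermP => [->|->|/eqP + /eqP]; case: tpermP => [->|->|/eqP + /eqP];
  rewrite -?val_eqE /=; lia.
Qed.

(** A simple transposition keeps the order of every pair of positions but its own, so only that pair
    can gain or lose the property. *)
Lemma card_ascents_simple i b :
  #|ascents (b \o simple_tperm i)| + (b (pos0 i) < b (pos1 i)) =
  #|ascents b| + (b (pos1 i) < b (pos0 i)).
Proof.
pose p0 := (pos0 i, pos1 i);
  pose f (p : 'I_n * 'I_n) := (simple_tperm i p.1, simple_tperm i p.2).
have sK : involutive (simple_tperm i) by move=> x; rewrite /simple_tperm tpermK.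
have fK : involutive f by move=> [x y]; rewrite /f /= !sK.
rewrite (cardsD1 p0 (ascents (b \o _))) (cardsD1 p0 (ascents b)).
have -> : #|ascents (b \o simple_tperm i) :\ p0| = #|ascents b :\ p0|.
  rewrite -(card_imset (mem (ascents b :\ p0)) (can_inj fK)); apply: eq_card => q.
  have -> : (q \in [set f x | x in ascents b :\ p0]) = (f q \in ascents b :\ p0).
    apply/imsetP/idP => [[q' H ->]|H]; first by rewrite fK.
    by exists (f q); rewrite ?fK.
  case: q => x y; rewrite !inE /=.
  have H u v : (u, v) != p0 -> u < v ->
    (f (u, v) != p0) && (simple_tperm i u < simple_tperm i v).
    move=> uv ltuv; rewrite (simple_tperm_ltn ltuv uv) andbT.
    apply: contraL ltuv => /eqP fE; rewrite -[(u, v)]fK in uv *.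
    have [-> ->] : u = pos1 i /\ v = pos0 i.
      have := fK (u, v); rewrite fE /f /p0 /= /simple_tperm tpermL tpermR.
      by case.
    by rewrite -leqNgt /= leqnSn.
  apply/and3P/and3P => [[h1 h2 h3]|[h1 h2 h3]].
    by have /andP[-> ->] := H _ _ h1 h2.
  by have := H _ _ h1 h2; rewrite /f /= !sK => /andP[-> ->].
rewrite !inE /= /simple_tperm tpermL tpermR ltnSn /=; rewrite addnAC [RHS]addnAC;
  congr addn; apply: addnC.
Qed.

Lemma ascents_comp_eq b b' : b =1 b' -> ascents b = ascents b'.
Proof. by move=> E; apply/setP => p; rewrite !inE !E. Qed.

Lemma ascents0 b : (forall x y, x < y -> b y <= b x) -> #|ascents b| = 0.
Proof.
move=> H; apply: eq_card0 => -[x y]; rewrite !inE /=.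
by apply/negbTE/negP => /andP[/H]; rewrite leqNgt => /negbTE ->.
Qed.

Lemma decreasing_local b : (forall i, b (pos1 i) <= b (pos0 i)) ->
  forall x y, x < y -> b y <= b x.
Proof.
move=> H x y; have [k] := ubnP (y - x); elim: k y => // k IHk y dk xy.
have hy : y.-1 < n.-1 by have := ltn_ord y; lia.
pose i := Ordinal hy.
have -> : y = pos1 i by apply: val_inj => /=; lia.
apply: leq_trans (H i) _; have [xi|xi] := eqVneq x (pos0 i); first by rewrite xi.
move: xi; rewrite -val_eqE /= => xi; apply: IHk => /=; lia.
Qed.

Lemma word_perm_cons i s : word_perm (i :: s) = (simple_tperm i * word_perm s)%g.
Proof. by rewrite /word_perm big_cons. Qed.

Section Sorted.
Variable srt : 'I_n -> nat.
Hypothesis srt_dec : forall x y, x < y -> srt y <= srt x.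

(** Each letter removes at most one ascent, and none is left at the end. *)
Lemma ascents_le_size s b : (forall x, srt (word_perm s x) = b x) ->
  #|ascents b| <= size s.
Proof.
elim: s b => [|i s IHs] b H.
  rewrite ascents0 // => x y; rewrite -!H /word_perm big_nil !perm1; exact: srt_dec.
have Hs x : srt (word_perm s x) = (b \o simple_tperm i) x.
  by rewrite /= -H word_perm_cons permM /simple_tperm tpermK.
by have := IHs _ Hs; have := card_ascents_simple i b; rewrite /=; lia.
Qed.

End Sorted.

Lemma sort_comp_dec (b : 'X_{1..n}) x y : x < y -> sort_comp b y <= sort_comp b x.
Proof.
move=> xy; rewrite /sort_comp /fun_of_multinom /= !(tnth_nth 0) /=.
have sb : sorted geq (sort geq b) by apply: sort_sorted => u v; apply: leq_total.
have tr : transitive geq by move=> u v w uv vw; apply: leq_trans uv.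
by apply: (sorted_ltn_nth tr) => //; rewrite inE size_sort size_tuple.
Qed.

Lemma sort_comp_eq (b b' : 'X_{1..n}) : perm_eq b b' -> sort_comp b = sort_comp b'.
Proof.
move=> pb; rewrite /sort_comp; congr Multinom; apply: val_inj => /=.
apply/perm_sortP => //.
- by move=> u v; apply: leq_total.
- by move=> u v w uv vw; apply: leq_trans uv.
- by move=> u v; rewrite andbC => /anti_leq.
Qed.

Lemma sort_comp_id (b : 'X_{1..n}) : (forall x y, x < y -> b y <= b x) -> sort_comp b = b.
Proof.
move=> H; case: b H => t H; rewrite /sort_comp; congr Multinom; apply: val_inj => /=.
apply: sorted_sort; first by move=> u v w uv vw; apply: leq_trans uv.
apply/(sortedP 0) => k; rewrite size_tuple => kn /=.
have := H (Ordinal (ltnW kn)) (Ordinal kn) (ltnSn k).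
by rewrite /fun_of_multinom /= !(tnth_nth 0).
Qed.

Definition act_comp i (b : 'X_{1..n}) : 'X_{1..n} := [multinom b (simple_tperm i x) | x < n].

Lemma sort_act_comp i (b : 'X_{1..n}) : sort_comp (act_comp i b) = sort_comp b.
Proof.
apply: sort_comp_eq; apply/tuple_permP; exists (simple_tperm i).
suff -> : multinom_val (act_comp i b) = [tuple tnth b (simple_tperm i x) | x < n] by [].
by apply: eq_from_tnth => x; rewrite !tnth_mktuple.
Qed.

(** Bubble sort: each swap of an adjacent ascent removes exactly one ascent. *)
Lemma sorting_word (b : 'X_{1..n}) : exists2 s,
  size s = #|ascents b| & forall x, sort_comp b (word_perm s x) = b x.
Proof.
have [k] := ubnP #|ascents b|; elim: k b => // k IHk b bk.
case: (pickP (fun i => b (pos0 i) < b (pos1 i))) => [i bi|nb].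
  have actE : act_comp i b =1 b \o simple_tperm i by move=> x; rewrite mnmE.
  have := card_ascents_simple i b;
    rewrite -(ascents_comp_eq actE) bi ltnNge (ltnW bi) /= addn1 addn0 => E.
  case: (IHk (act_comp i b)) => [|s s1 s2]; first by rewrite -ltnS E.
  exists (i :: s); first by rewrite /= s1.
  move=> x; rewrite word_perm_cons permM -(sort_act_comp i) s2 actE /=.
  by rewrite /simple_tperm tpermK.
have dec : forall x y, x < y -> b y <= b x.
  by apply: decreasing_local => i; rewrite leqNgt nb.
exists [::]; first by rewrite ascents0.
by move=> x; rewrite /word_perm big_nil perm1 sort_comp_id.
Qed.

Lemma size_reduced_sorting (b : 'X_{1..n}) :
  size (reduced_word (sorting_perm b)) = #|ascents b|.
Proof.
have rw w : word_perm (reduced_word w) = w by apply/eqP/(xchooseP (reduced_word_ex w)).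
rewrite size_tuple; apply/eqP; rewrite eqn_leq /sorting_perm.
case: arg_minnP => [|w /forallP wb wmin]; first exact: xchooseP.
apply/andP; split; last first.
  rewrite -(size_tuple (xchoose (reduced_word_ex w))).
  apply: (ascents_le_size (@sort_comp_dec b)) => x.
  by rewrite [word_perm _]rw; apply/eqP.
have [s <- sb] := sorting_word b.
apply: (@leq_trans (perm_length (word_perm s))).
  by apply: wmin; apply/forallP => x; apply/eqP.
rewrite /perm_length; case: ex_minnP => m _; apply.
by apply/existsP; exists (in_tuple s).
Qed.

Lemma sends_sorting_perm (b : 'X_{1..n}) x : sort_comp b (sorting_perm b x) = b x.
Proof.
rewrite /sorting_perm; case: arg_minnP => [|w /forallP wb _]; first exact: xchooseP.
exact/eqP.
Qed.

(** Stated for every shortest sorting word, since the tail of such a word is again one, for the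
    rearranged composition. *)
Lemma demazure_word_key_sum s (b : 'X_{1..n}) p h : (forall x, b x <= h) ->
    p = \sum_x b x -> size s = #|ascents b| ->
    (forall x, sort_comp b (word_perm s x) = b x) ->
  foldr (@demazure n) 'X_[sort_comp b] s = key_sum p (key_word (b \o @rev_ord n) h).
Proof.
elim: s b => [|i s IHs] b bh pE sz sb /=.
  have bE : sort_comp b = b.
    by apply/mnmP => x; rewrite -sb /word_perm big_nil perm1.
  rewrite key_sum_base /= => [|x y xy|x|].
  - by congr mpolyX; rewrite bE; apply/mnmP => x; rewrite mnmE rev_ordK.
  - by rewrite -bE; apply: sort_comp_dec => /=; have := ltn_ord y; lia.
  - exact: bh.
  - by rewrite pE (reindex_inj (@rev_ord_inj n)).
have actE : act_comp i b =1 b \o simple_tperm i by move=> x; rewrite mnmE.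
have sb' x : sort_comp (act_comp i b) (word_perm s x) = act_comp i b x.
  by rewrite sort_act_comp actE /= -sb word_perm_cons permM /simple_tperm tpermK.
have := card_ascents_simple i b; rewrite -(ascents_comp_eq actE) -sz /=.
have := ascents_le_size (@sort_comp_dec _) sb' => E1 E2.
(* The tail has at least as many letters as there are ascents left, so the first letter must remove
   one; this gives the inequality needed by the recursion. *)
have [mE bi] : #|ascents (act_comp i b)| = size s /\ b (pos0 i) < b (pos1 i).
  by move: E1 E2; move: #|ascents _| => m; case: (ltnP (b (pos0 i))); case: ltnP => /=; lia.
have bh' x : act_comp i b x <= h by rewrite actE; apply: bh.
have pE' : p = \sum_x act_comp i b x.
  by rewrite pE (reindex_inj (@perm_inj _ (simple_tperm i))); apply: eq_bigr => x _;
    rewrite actE.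
rewrite -(sort_act_comp i) (IHs (act_comp i b) bh' pE' (esym mE) sb').
apply: key_sum_step => [|x] /=; rewrite !actE /= !rev_ordK.
  by rewrite /simple_tperm tpermL tpermR ltnW.
by rewrite /simple_tperm tpermK.
Qed.

Lemma key_poly_key_sum (b : 'X_{1..n}) h : (forall x, b x <= h) ->
  key_poly b = key_sum (\sum_x b x) (key_word (b \o @rev_ord n) h).
Proof.
move=> bh; apply: demazure_word_key_sum => //; first exact: size_reduced_sorting.
move=> x; rewrite -[RHS]sends_sorting_perm; congr (sort_comp b _).
have /eqP E := xchooseP (reduced_word_ex (sorting_perm b)).
by rewrite -{2}E.
Qed.

End Inversions.

(** * From compatible pairs to biwords *)

(** [rev_ord] reverses the order, so an ascent of [c] is a descent of [flip c], where lexicographic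
    order demands a strict step of [w]. *)
Lemma compatible_biword n p (c w : p.-tuple 'I_n) :
  compatible c w = sorted lex_le (zip w (flip c)) && all flagged (zip w (flip c)).
Proof.
have sz : size (zip w (flip c)) = p by rewrite size_zip !size_tuple minnn.
(* A nonempty tuple supplies default letters for [nth]. *)
have [p0|/negP p0] := boolP [exists k : 'I_p, true]; last first.
  have pz : p = 0.
    apply/eqP; rewrite -leqn0 leqNgt; apply/negP => p1; apply: p0.
    by apply/existsP; exists (Ordinal p1).
  subst p; rewrite (tuple0 c) (tuple0 w) /compatible /=.
  by apply/andP; split; apply/forallP => k; have := ltn_ord k.
case/existsP: p0 => k0 _; set y := tnth w k0; set x := tnth c k0.
have zE k : k < p -> nth (y, rev_ord x) (zip w (flip c)) k = (nth y w k, rev_ord (nth x c k)).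
  move=> kp; rewrite nth_zip ?size_tuple // (nth_map x) ?size_tuple //.
have ww (k : 'I_p) : tnth w k = nth y w k by rewrite (tnth_nth y).
have cc (k : 'I_p) : tnth c k = nth x c k by rewrite (tnth_nth x).
apply/and3P/andP => [[/(sortedP y) Sw /forallP Scw /forallP F]|[/(sortedP (y, rev_ord x)) S
  /(all_nthP (y, rev_ord x)) F]].
  split.
    apply/(sortedP (y, rev_ord x)) => k; rewrite sz => kp.
    rewrite !zE ?(ltnW kp) // /lex_le /=.
    have := Scw (Ordinal (ltnW kp)) => /forallP/(_ (Ordinal kp)).
    rewrite !ww !cc /= eqxx /=; have := Sw k; rewrite size_tuple => /(_ kp).
    have := ltn_ord (nth x c k); have := ltn_ord (nth x c k.+1).
    rewrite -val_eqE /=; case: ltnP => /=; lia.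
  apply/(all_nthP (y, rev_ord x)) => k; rewrite sz => kp; rewrite zE // /flagged /=.
  have := F (Ordinal kp); rewrite ww cc /=.
  have := ltn_ord (nth x c k); lia.
have {}S k : k.+1 < p -> (nth y w k < nth y w k.+1) ||
    ((nth y w k == nth y w k.+1) && (nth x c k.+1 <= nth x c k)).
  move=> kp; have := S k; rewrite sz => /(_ kp); rewrite !zE ?(ltnW kp) // /lex_le /=.
  by have := ltn_ord (nth x c k); have := ltn_ord (nth x c k.+1); lia.
split.
- apply/(sortedP y) => k; rewrite size_tuple => /S.
  by case/orP => [/ltnW|/andP[/eqP ->]].
- apply/forallP => k; apply/forallP => l; rewrite !ww !cc; apply/implyP => /andP[/eqP lk].
  have := ltn_ord l; rewrite lk => /S /orP[//|/andP[_]].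
  by rewrite leqNgt => /negbTE ->.
- apply/forallP => k; rewrite ww cc; have := F k; rewrite sz => /(_ (ltn_ord k)).
  by rewrite zE // /flagged /=; have := ltn_ord (nth x c k); lia.
Qed.

Local Open Scope ring_scope.

(** Pairs (c, w) are reindexed by zipping [w] with [flip c]; flipping [w] amounts to reversing the
    variables. *)
Lemma sum_compatible_key_sum n p (K : seq 'I_n) (kp : size K == p) :
  \sum_(c : p.-tuple 'I_n | knuth_equiv (flip c) (Tuple kp))
    \sum_(w : p.-tuple 'I_n | compatible c w) 'X_[word_comp (flip w)] =
  key_sum p K \mPo [tuple 'X_(rev_ord i) | i < n] :> {mpoly int[n]}.
Proof.
rewrite pair_big_dep /= raddf_sum /=.
pose tw (z : p.-tuple ('I_n * 'I_n)) := [tuple of map fst z].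
pose tc (z : p.-tuple ('I_n * 'I_n)) := flip [tuple of map snd z].
have flipK (c : p.-tuple 'I_n) : flip (flip c) = c.
  by apply: val_inj; rewrite /= -map_comp map_id_in // => x _; rewrite /= rev_ordK.
rewrite (reindex (fun z => (tc z, tw z))) /=; last first.
  exists (fun q : p.-tuple 'I_n * p.-tuple 'I_n => [tuple of zip q.2 (flip q.1)]).
    move=> z _; rewrite /tc flipK; apply: val_inj; exact: zip_unzip.
  move=> [c w] _ /=; congr (_, _); apply: val_inj.
    rewrite -[in RHS](flipK c) /=; congr map; apply: unzip2_zip.
    by rewrite size_map !size_tuple.
  by apply: unzip1_zip; rewrite size_map !size_tuple.
apply: eq_big => [z|z _].
  have fE : flip (tc z) = [tuple of map snd z] by rewrite /tc flipK.
  have zE : zip (tw z) (flip (tc z)) = z by rewrite fE; apply: zip_unzip.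
  rewrite compatible_biword zE fE andbC -andbA; congr [&& _, _ & _].
  apply/knuth_equivP/placticP; exact: id.
rewrite comp_mpolyX; symmetry.
rewrite mpolyXE_id [RHS](reindex_inj (@rev_ord_inj n)); apply: eq_bigr => i _.
rewrite tnth_mktuple !mnmE /=; congr (_ ^+ _).
rewrite -map_comp [in RHS]count_map; rewrite count_map; apply: eq_count => q /=.
by rewrite (inj_eq (@rev_ord_inj n)).
Qed.

Unset Implicit Arguments.

Theorem mainTheorem2 (n : nat) (a : 'X_{1..n}) :
  young_key_poly a =
    \sum_(c : (size (column_word (key a))).-tuple 'I_n
            | knuth_equiv (flip c) (in_tuple (column_word (key a))))
      \sum_(w : (size (column_word (key a))).-tuple 'I_n | compatible c w)
        'X_[word_comp (flip w)].
Proof.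
have [h ah KE] := key_wordP a.
rewrite sum_compatible_key_sum /young_key_poly (@key_poly_key_sum _ _ h); last first.
  by move=> x; rewrite mnmE.
(* The key polynomial is taken at rev(a), and its expansion reverses once more, which gives back the
   key word of [a]. *)
congr (key_sum _ _ \mPo _); last first.
  by rewrite KE; apply: eq_key_word => x; rewrite /= mnmE rev_ordK.
rewrite KE size_key_word // [RHS](reindex_inj (@rev_ord_inj n)).
by apply: eq_bigr => x _; rewrite mnmE.
Qed.
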